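(* Let $T\in\mathbb{N}^*$, $\rho>0$, $\alpha\in\mathbb{R}$. For $N\in\mathbb{N}^*$ let $W_N$ be an $N\times N$ random matrix with i.i.d. $\mathcal{N}(0,\rho^2/N^{2\alpha})$ entries, and $B_{T,N}$ its generalised matrix of moments of order $T$, with eigenvalues $\lambda_T(B_{T,N})\le\cdots\le\lambda_0(B_{T,N})$ ($\lambda_{\min}=\lambda_T$, $\lambda_{\max}=\lambda_0$). As $N\to\infty$: (1) If $\alpha=1/2$: $\lambda_{\max}(B_{T,N})\simeq N\max(1,\rho^2,\ldots,\rho^{2T})$, $\lambda_{\min}(B_{T,N})\simeq N\min(1,\rho^2,\ldots,\rho^{2T})$, and \[\lim_{N\to\infty}\frac{\lambda_{\max}(B_{T,N})}{\sum_{i=0}^T\lambda_i(B_{T,N})}=\frac{\max(1,\rho^2,\ldots,\rho^{2T})}{\sum_{i=0}^T\rho^{2i}}.\] (2) If $\alpha<1/2$: $\lambda_{\max}(B_{T,N})\simeq\rho^{2T}N^{1+2T(\frac12-\alpha)}$ and $\lambda_{\max}(B_{T,N})/\sum_{i=0}^T\lambda_i(B_{T,N})\to1$. (3) If $\alpha>1/2$: $\lambda_{\max}(B_{T,N})\simeq N$ and $\lambda_{\max}(B_{T,N})/\sum_{i=0}^T\lambda_i(B_{T,N})\to1$.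
   Context: Generalised matrix of moments: for $i\in[N]$, $\beta_{i,0}=1$, $\beta_{i,l}=\sum_{i_1,\ldots,i_l=1}^N W_{ii_1}\cdots W_{i_{l-1}i_l}$ for $l\ge1$, and $B_{T,N}(l_1,l_2)=\mathbb{E}\sum_{i=1}^N\beta_{i,l_1}\beta_{i,l_2}$. $x_N\simeq y_N$ means $x_N/y_N\to1$. *)

(* Defs.v *)
From HB Require Import structures.
From mathcomp Require Import all_boot all_order all_algebra.
From mathcomp Require Import all_classical all_reals all_analysis.
Set Implicit Arguments. Unset Strict Implicit. Unset Printing Implicit Defensive.
Import Order.TTheory GRing.Theory Num.Theory.
Import numFieldNormedType.Exports.
Local Open Scope classical_set_scope.
Local Open Scope ring_scope.

(* Mutual independence of a finite family of real random variables:
   product rule for every choice of Borel sets (taking A k = setT for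
   unused indices gives the product rule for every subfamily). *)
Definition mutually_independent {d} {Omega : measurableType d} {R : realType}
  (P : probability Omega R) {I : finType} (X : I -> {RV P >-> R}) : Prop :=
  forall A : I -> set R, (forall k, measurable (A k)) ->
    P (\bigcap_(k in [set: I]) (X k @^-1` A k)) =
    (\big[*%E/1%E]_(k : I) P (X k @^-1` A k))%E.

(* beta_{i,l} = sum_{i_1..i_l} W_{i i_1} W_{i_1 i_2} ... W_{i_{l-1} i_l};
   beta_{i,0} = 1 (empty sum over the unique 0-tuple of the empty product). *)
Definition beta {R : realType} {N : nat} (W : 'I_N -> 'I_N -> R) (i : 'I_N) (l : nat) : R :=
  \sum_(p : l.-tuple 'I_N)
     \prod_(k < l) W (nth i (i :: p) k) (nth i (i :: p) k.+1).

Definition moment_matrix {d} {Omega : measurableType d} {R : realType}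
  (P : probability Omega R) {N : nat} (W : 'I_N -> 'I_N -> {RV P >-> R}) (T : nat)
  : 'M[R]_(T.+1) :=
  \matrix_(l1 < T.+1, l2 < T.+1)
     fine ('E_P[ (fun w => \sum_(i < N) beta (fun a b => W a b w) i l1
                                     * beta (fun a b => W a b w) i l2)%R ])%E.

Definition sorted_eigenvalues {R : realType} {n : nat} (A : 'M[R]_n)
  (lam : 'I_n -> R) : Prop :=
  char_poly A = \prod_(i < n) ('X - (lam i)%:P) /\
  (forall i j : 'I_n, (i <= j)%N -> lam j <= lam i).

Arguments mutually_independent {d Omega R} P {I} X.
Arguments moment_matrix {d Omega R} P {N} W T.

(* Main.v *)
Require Import Defs.
From HB Require Import structures.
From mathcomp Require Import all_boot all_order all_algebra finmap.
From mathcomp Require Import all_classical all_reals all_analysis.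
From mathcomp Require Import measurable_realfun perm zify ring lra.
Import Order.TTheory GRing.Theory Num.Theory.
Import numFieldNormedType.Exports.
Set Implicit Arguments. Unset Strict Implicit. Unset Printing Implicit Defensive.

(** With [sigma] the standard deviation of the entries and [s = sigma sqrt N], the
    entry [B(l1,l2)] is a sum over pairs of walks [(p, q)] of lengths [l1, l2] from a
    common root [i] of a product of Gaussian moments, one per directed edge; a term
    vanishes unless every edge is used an even number of times. Then every vertex of
    [p ++ q] is entered at least twice, so at most [(l1 + l2)/2] vertices other than
    the root occur, and if the bound is attained then [p = q] is self-avoiding.
    Counting gives [B(l1,l2) = N s^(l1+l2) (delta(l1,l2) + O(1/N))]. Dividing by [N]
    (when [alpha >= 1/2]) or by [N s^(2T)] (when [alpha < 1/2]), the matrices converge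
    to a diagonal one, and so do the eigenvalues: Gershgorin's theorem puts each of
    them near a diagonal entry of the limit, and since [det(d_k - A_N) -> 0] each
    diagonal entry [d_k] is approached by some eigenvalue. *)

(** * Pairs of walks in which every edge has even multiplicity *)

Lemma sum_count_undup (U : eqType) (s : seq U) : \sum_(v <- undup s) count_mem v s = size s.
Proof.
rewrite -sum1_size -[RHS]big_undup_iterop_count; apply: eq_bigr => v _.
by elim: (count_mem v s) => // -[|n] //= {1}->.
Qed.

Section Walks.
Variable V : eqType.
Implicit Types (i v : V) (p q s : seq V).

Definition walk_edges i p : seq (V * V) := pairmap pair i p.

Lemma size_undup_count2 s : (forall v, v \in s -> 2 <= count_mem v s) ->
  2 * size (undup s) <= size s.
Proof.
move=> h; rewrite -(sum_count_undup s) -sum1_size big_distrr /= big_seq [leqRHS]big_seq.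
by apply: leq_sum => v; rewrite mem_undup => /h.
Qed.

(** Since [size s] is the sum of the multiplicities, all at least 2, a single multiplicity above 2
    would push it past twice the number of distinct elements. *)
Lemma count2_tight s : (forall v, v \in s -> 2 <= count_mem v s) ->
  size s <= 2 * size (undup s) -> forall v, v \in s -> count_mem v s = 2.
Proof.
move=> h hs v vs; apply/eqP; rewrite eqn_leq h // andbT leqNgt; apply/negP => v3.
suff : 2 * size (undup s) < size s by lia.
rewrite -(sum_count_undup s) (perm_size (perm_to_rem (_ : v \in undup s))) ?mem_undup //=.
rewrite (big_rem v) ?mem_undup //= mulnS -addSn.
apply: leq_add; first by [].
rewrite -sum1_size big_distrr /= big_seq [leqRHS]big_seq.
by apply: leq_sum => w /mem_rem; rewrite mem_undup => /h.
Qed.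

Lemma unzip2_walk_edges i p : unzip2 (walk_edges i p) = p.
Proof. by elim: p i => //= x p IH i; rewrite IH. Qed.

Lemma mem_walk_edges x0 i p k : k < size p ->
  (nth x0 (i :: p) k, nth x0 p k) \in walk_edges i p.
Proof.
move=> kp; rewrite -(nth_pairmap x0 (x0, x0)) //.
by apply: mem_nth; rewrite size_pairmap.
Qed.

Section Tight.
Variables (i : V) (D : seq (V * V)).
Hypothesis uniq_pred : forall u u' v, (u, v) \in D -> (u', v) \in D -> u = u'.

(** Both walks are traced back from the common vertex along unique predecessors. The root does not
    recur, so they reach it after the same number of steps. *)
Lemma walk_index_eq p' q' a b : {subset walk_edges i p' <= D} ->
  {subset walk_edges i q' <= D} -> i \notin p' -> i \notin q' ->
  a <= size p' -> b <= size q' ->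
  nth i (i :: p') a = nth i (i :: q') b -> a = b.
Proof.
move=> hp hq ip iq; elim: a b => [|a IH] [|b] //= ha hb.
- by move=> e; case/negP: iq; rewrite e mem_nth.
- by move=> e; case/negP: ip; rewrite -e mem_nth.
move=> e; congr S; apply: IH; [exact: ltnW|exact: ltnW|].
apply: uniq_pred (hp _ (mem_walk_edges i i ha)) _; rewrite e.
exact: hq (mem_walk_edges i i hb).
Qed.
End Tight.

(* The targets of the edges list p ++ q, so every target is hit at least twice.
   When the bound is tight, each vertex has a unique predecessor and the root has
   none, so its depth is determined by following predecessors back to the root. *)
Lemma even_walks i p q :
  (forall e, ~~ odd (count_mem e (walk_edges i p ++ walk_edges i q))) ->
  2 * size (undup (i :: p ++ q)) <= size p + size q \/ (p = q /\ uniq (i :: p)).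
Proof.
set D := _ ++ _ => even; rewrite -size_cat.
have DE : unzip2 D = p ++ q by rewrite /D /unzip2 map_cat -/unzip2 !unzip2_walk_edges.
have cD v : count_mem v (p ++ q) = count (fun e => e.2 == v) D.
  by rewrite -DE count_map; apply: eq_count => e.
have D2 e : e \in D -> 2 <= count_mem e D.
  by rewrite -has_pred1 has_count; move: (even e); case: (count_mem e D) => [|[|]].
have inD v : v \in p ++ q -> exists u, (u, v) \in D.
  by rewrite -DE => /mapP [[u w] uD /= ->]; exists u.
have h2 v : v \in p ++ q -> 2 <= count_mem v (p ++ q).
  move=> /inD[u uD]; apply: leq_trans (D2 _ uD) _; rewrite cD.
  by apply: sub_count => e /= /eqP ->.
have le2 := size_undup_count2 h2.
have [ip /=|ip /=] := boolP (i \in p ++ q); rewrite ?ip ?(negPf ip); first by left.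
have [?|tight] := leqP (2 * (size (undup (p ++ q))).+1) (size (p ++ q)); first by left.
right.
(* The length is a sum of even multiplicities. With [m] distinct vertices it is [2m] or [2m + 1] at
   this point, so parity forces [2m]. *)
have even_size : ~~ odd (size (p ++ q)).
  rewrite -DE size_map -sum_count_undup; elim: (undup D) => [|e r IH]; rewrite ?big_nil //.
  by rewrite big_cons oddD negb_add (negPf (even e)) (negPf IH).
have c2 := count2_tight h2 (_ : size (p ++ q) <= _).
have {}c2 v : v \in p ++ q -> count_mem v (p ++ q) = 2 by apply: c2; lia.
(* Two different edges into [v], each used at least twice, would give [v] multiplicity at least 4
   instead of 2. *)
have up u u' v : (u, v) \in D -> (u', v) \in D -> u = u'.
  move=> uD u'D; apply/eqP/negPn/negP => uu'.
  have vpq : v \in p ++ q by rewrite -DE; apply/mapP; exists (u, v).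
  have := c2 _ vpq; rewrite cD.
  have := count_predUI (pred1 (u, v)) (pred1 (u', v)) D.
  have -> : count (predI (pred1 (u, v)) (pred1 (u', v))) D = 0.
    apply/eqP; rewrite -leqn0 leqNgt -has_count; apply/hasP => -[e _ /= /andP[/eqP-> /eqP[]]].
    by move/eqP; rewrite (negPf uu').
  have : count (predU (pred1 (u, v)) (pred1 (u', v))) D <= count (fun e => e.2 == v) D.
    by apply: sub_count => e /= /orP[]/eqP->/=.
  have := D2 _ uD; have := D2 _ u'D; lia.
move: (ip); rewrite mem_cat negb_or => /andP[inp inq].
have sp : {subset walk_edges i p <= D} by move=> e ep; rewrite mem_cat ep.
have sq : {subset walk_edges i q <= D} by move=> e ep; rewrite mem_cat ep orbT.
have uniq_of r : {subset walk_edges i r <= D} -> i \notin r -> uniq r.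
  move=> sr ir; apply/(uniqP i) => a b; rewrite !inE => ha hb e.
  by have /= := @walk_index_eq _ _ up r r a.+1 b.+1 sr sr ir ir ha hb e; case.
have up_ := uniq_of _ sp inp; have uq_ := uniq_of _ sq inq.
(* Each vertex occurs twice in [p ++ q] but at most once in either walk, hence once in both. *)
have pq v : (v \in p) = (v \in q).
  apply/idP/idP => vr.
    have := c2 v; rewrite mem_cat vr => /(_ isT); rewrite count_cat !count_uniq_mem // vr.
    by case: (v \in q).
  have := c2 v; rewrite mem_cat vr orbT => /(_ isT); rewrite count_cat !count_uniq_mem // vr.
  by case: (v \in p).
split; last by rewrite /= inp.
have szpq : size p = size q by apply/eqP; rewrite eqn_leq !uniq_leq_size // => v; rewrite pq.
apply: (@eq_from_nth _ i) => // a ap.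
have : nth i p a \in q by rewrite -pq mem_nth.
case/(nthP i) => b bq e.
have /= := @walk_index_eq _ _ up p q a.+1 b.+1 sp sq inp inq ap bq (esym e).
by case=> ab; rewrite -e ab.
Qed.

(** A repeated edge would repeat its target. So when a self-avoiding walk is taken twice, every edge
    it uses has multiplicity exactly 2. *)
Lemma count_edges_uniq i p e : uniq (i :: p) -> count_mem e (walk_edges i p) <= 1.
Proof.
move=> /= /andP[_ up]; have := count_uniq_mem e.2 up.
rewrite -{1}(unzip2_walk_edges i p) count_map => h.
apply: (@leq_trans (count (preim snd (pred1 e.2)) (walk_edges i p))).
  by apply: sub_count => x /= /eqP ->.
by rewrite h; case: (_ \in _).
Qed.

End Walks.

(* A tuple with at most m distinct entries factors through 'I_m. *)
Lemma card_few_distinct (N n m : nat) : 0 < n ->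
  #|[set t : n.-tuple 'I_N | size (undup t) <= m]| <= m ^ n * N ^ m.
Proof.
move=> n0; pose F (gh : m.-tuple 'I_N * n.-tuple 'I_m) : n.-tuple 'I_N :=
  [tuple tnth gh.1 (tnth gh.2 k) | k < n].
apply: (@leq_trans #|F @: [set: _ * _]|); last first.
  by apply: leq_trans (leq_imset_card _ _) _; rewrite cardsT card_prod !card_tuple !card_ord mulnC.
apply/subset_leq_card/fintype.subsetP => t; rewrite inE => tm.
(* The tuple is coded by the list of its distinct entries, padded with [x0] to length [m], together
   with the position of each entry in that list. *)
pose x0 := tnth t (Ordinal n0).
pose g : m.-tuple 'I_N := [tuple nth x0 (undup t) k | k < m].
have hP (k : 'I_n) : index (tnth t k) (undup t) < m.
  by apply: leq_trans tm; rewrite index_mem mem_undup mem_tnth.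
apply/imsetP; exists (g, [tuple Ordinal (hP k) | k < n]); rewrite ?inE //.
apply: eq_from_tnth => k; rewrite !tnth_mktuple /=.
by rewrite nth_index // mem_undup mem_tnth.
Qed.

(** * Counting pairs of walks and summing their weights *)

Local Open Scope ring_scope.

Lemma prod_seq_count (R : comNzRingType) (T : finType) (s : seq T) (F : T -> R) :
  \prod_(x <- s) F x = \prod_x F x ^+ count_mem x s.
Proof.
elim: s => [|y s IH]; first by rewrite big_nil big1.
rewrite big_cons IH (bigD1 y) //= [RHS](bigD1 y) //= eqxx exprS mulrA; congr (_ * _).
by apply: eq_bigr => x /negPf xy; rewrite eq_sym xy.
Qed.

Lemma sum_count_mem (T : finType) (s : seq T) : (\sum_x count_mem x s = size s)%N.
Proof.
elim: s => [|y s IH]; first by rewrite big1.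
rewrite /= big_split /= IH (bigD1 y) //= eqxx big1 // => x /negPf xy.
by rewrite eq_sym xy.
Qed.

(** These are the pairs of leading order: one self-avoiding walk taken twice. The comparison is
    between sequences because the two length indices need not agree. *)
Definition diag_walk N l1 l2 (x : 'I_N * (l1.-tuple 'I_N * l2.-tuple 'I_N)) : bool :=
  (tval x.2.1 == tval x.2.2) && uniq (x.1 :: x.2.1).

(** Such pairs correspond to injective tuples of length [l.+1]. A tuple that is not injective has at
    most [l] distinct entries, so [card_few_distinct] bounds the defect. *)
Lemma sum_diag_walk N l :
  (\sum_(x : 'I_N * (l.-tuple 'I_N * l.-tuple 'I_N)) diag_walk x <= N ^ l.+1 <=
   \sum_(x : 'I_N * (l.-tuple 'I_N * l.-tuple 'I_N)) diag_walk x + l ^ l.+1 * N ^ l)%N.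
Proof.
pose U := [set t : l.+1.-tuple 'I_N | uniq t].
have -> : (\sum_(x : 'I_N * (l.-tuple 'I_N * l.-tuple 'I_N)) diag_walk x = #|U|)%N.
  pose F (t : l.+1.-tuple 'I_N) := (thead t, ([tuple of behead t], [tuple of behead t])).
  have Finj : injective F.
    move=> t t' [h ht _]; apply: val_inj.
    by rewrite /= (tuple_eta t) (tuple_eta t') /= h ht.
  rewrite -big_mkcond sum1_card -(card_imset U Finj); apply: eq_card => -[i [p q]].
  rewrite unfold_in; apply/idP/imsetP.
    rewrite /diag_walk /= => /andP[/eqP/val_inj <- un].
    by exists [tuple of i :: p]; rewrite ?inE //; congr (_, (_, _)); apply: val_inj.
  by case=> t; rewrite inE => ut [-> -> ->]; move: ut; rewrite /diag_walk /= eqxx {1}(tuple_eta t).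
have <- : #|{: l.+1.-tuple 'I_N}| = (N ^ l.+1)%N by rewrite card_tuple card_ord.
rewrite max_card -(cardC (mem U)) leq_add2l.
apply: leq_trans (card_few_distinct N l (ltn0Sn l)).
apply/subset_leq_card/fintype.subsetP => t; rewrite !inE => nu.
by have := ltn_size_undup t; rewrite nu size_tuple ltnS.
Qed.

Section WalkSum.
Variables (R : realFieldType) (N l1 l2 : nat) (mm : nat -> R) (M : R).
Local Notation L := (l1 + l2)%N.
Local Notation Idx := ('I_N * (l1.-tuple 'I_N * l2.-tuple 'I_N))%type.
Hypothesis M1 : 1 <= M.
Hypothesis mm0 : mm 0 = 1.
Hypothesis mm2 : mm 2 = 1.
Hypothesis mm_odd : forall k, odd k -> mm k = 0.
Hypothesis mm_le : forall k, (k <= L)%N -> `|mm k| <= M ^+ k.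

Definition edges_pair (x : Idx) : seq ('I_N * 'I_N) :=
  walk_edges x.1 x.2.1 ++ walk_edges x.1 x.2.2.

Definition walk_term (x : Idx) : R := \prod_e mm (count_mem e (edges_pair x)).

Local Notation good := (@diag_walk N l1 l2).
Let few (x : Idx) : bool := (2 * size (undup (x.1 :: x.2.1 ++ x.2.2)) <= L)%N.

Lemma size_edges_pair x : size (edges_pair x) = L.
Proof. by rewrite size_cat !size_pairmap !size_tuple. Qed.

Lemma walk_term_le x : `|walk_term x| <= M ^+ L.
Proof.
rewrite /walk_term normr_prod -[X in _ <= _ ^+ X](size_edges_pair x) -sum_count_mem -prodrXr.
apply: ler_prod => e _; rewrite normr_ge0 mm_le //.
by rewrite -(size_edges_pair x) count_size.
Qed.

(** Outside [few], the dichotomy of [even_walks] determines the term exactly: either an edge of odd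
    multiplicity kills it, or the pair is diagonal and every used edge contributes [mm 2 = 1].
    Inside [few] a crude bound suffices. *)
Lemma walk_term_good x : `|walk_term x - (good x)%:R| <= (M ^+ L + 1) * (few x)%:R.
Proof.
have [few_x|nfew] := boolP (few x).
  rewrite mulr1; apply: le_trans (ler_normB _ _) _; apply: lerD; first exact: walk_term_le.
  by case: good; rewrite ?normr1 ?normr0.
rewrite mulr0 normr_le0 subr_eq0; apply/eqP.
have goodP : good x -> walk_term x = 1.
  case/andP => /eqP pq un; rewrite /walk_term big1 // => e _.
  rewrite /edges_pair -pq count_cat addnn.
  by have := count_edges_uniq e un; case: (count_mem _ _) => [|[|]].
have [gx|ngx] := boolP (good x); first by rewrite goodP.
case: (boolP [forall e, ~~ odd (count_mem e (edges_pair x))]) => [/forallP even|].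
  case: (even_walks even) => [h|[pq un]].
    by case/negP: nfew; rewrite /few; move: h; rewrite !size_tuple.
  by case/negP: ngx; rewrite /diag_walk pq eqxx -pq.
rewrite negb_forall => /existsP[e]; rewrite negbK => oe.
by rewrite /walk_term (bigD1 e) //= mm_odd // mul0r.
Qed.

(** The root is included among the at most [L./2] distinct entries, which saves a full power of [N]
    against the main term. *)
Lemma card_few : (\sum_x few x <= L./2 ^ L.+1 * N ^ L./2)%N.
Proof.
pose F (x : Idx) : L.+1.-tuple 'I_N := [tuple of x.1 :: [tuple of x.2.1 ++ x.2.2]].
have Finj : injective F.
  move=> [i [p q]] [i' [p' q']] /(congr1 val) /= [-> /eqP].
  by rewrite eqseq_cat ?size_tuple // => /andP[/eqP/val_inj-> /eqP/val_inj->].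
rewrite -big_mkcond sum1_card -(card_imset _ Finj) /=.
apply: leq_trans (card_few_distinct N L./2 (ltn0Sn L)).
apply/subset_leq_card/fintype.subsetP => t /imsetP[x xf ->].
by rewrite inE /=; move: xf; rewrite unfold_in /few /=; lia.
Qed.

(** The terms are replaced by the indicator of [diag_walk], and its sum by the main term. Each
    replacement costs at most order [N ^ L./2]; for [l1 != l2] no diagonal pair exists. *)
Lemma sum_walk_term :
  `|\sum_x walk_term x - (if l1 == l2 then N%:R ^+ l1.+1 else 0)|
    <= ((M ^+ L + 2) * (L./2 ^ L.+1 + L./2 ^ L./2.+1)%:R) * N%:R ^+ L./2.
Proof.
set G := if _ then _ else _.
have M0 : 0 <= M ^+ L by rewrite exprn_ge0 // (le_trans ler01).
have h1 : `|\sum_x walk_term x - \sum_x (good x)%:R| <=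
    (M ^+ L + 1) * (L./2 ^ L.+1 * N ^ L./2)%:R.
  rewrite -sumrB; apply: le_trans (ler_norm_sum _ _ _) _.
  apply: le_trans (ler_sum _ (fun x _ => walk_term_good x)) _.
  rewrite -mulr_sumr -natr_sum ler_wpM2l ?addr_ge0 //.
  by rewrite ler_nat card_few.
have h2 : `|\sum_x (good x)%:R - G| <= (L./2 ^ L./2.+1 * N ^ L./2)%:R :> R.
  rewrite /G; case: eqP => [l12|nl].
    case: l2 / l12; rewrite addnn doubleK -natr_sum -natrX distrC.
    have /andP[le1 le2] := sum_diag_walk N l1.
    by rewrite -natrB // normr_nat ler_nat leq_subLR.
  rewrite big1 ?subrr ?normr0 ?ler0n // => x _.
  case: (boolP (good x)) => // /andP[/eqP /(congr1 size)]; rewrite !size_tuple.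
  by move/nl.
have -> : \sum_x walk_term x - G = (\sum_x walk_term x - \sum_x (good x)%:R) +
  (\sum_x (good x)%:R - G) by ring.
apply: le_trans (ler_normD _ _) _; apply: le_trans (lerD h1 h2) _.
rewrite !natrM !natrX !natrD !natrX.
set a := (L./2%:R ^+ L.+1 : R); set b := (L./2%:R ^+ _ : R); set c := N%:R ^+ _.
have a0 : 0 <= a by rewrite exprn_ge0.
have b0 : 0 <= b by rewrite exprn_ge0.
have c0 : 0 <= c by rewrite exprn_ge0.
rewrite [leLHS](_ : _ = ((M ^+ L + 1) * a + b) * c); last by ring.
apply: ler_wpM2r => //; nra.
Qed.
End WalkSum.

Local Open Scope classical_set_scope.

(** * Eigenvalues of matrices converging to a diagonal matrix *)

(** The disc is the one of a coordinate [k] at which an eigenvector has largest modulus.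
    Eigenvectors are row vectors here, so the radius is a column sum. *)
Lemma gershgorin (R : realFieldType) n (A : 'M[R]_n.+1) (a : R) : eigenvalue A a ->
  exists k, `|a - A k k| <= \sum_(j | j != k) `|A j k|.
Proof.
case/eigenvalueP => v vA v0.
pose k := [arg max_(k > ord0) `|v 0 k|]%O.
have vk j : `|v 0 j| <= `|v 0 k|.
  by rewrite /k; case: arg_maxP => // i _ h; exact: h.
have vk0 : 0 < `|v 0 k|.
  rewrite lt_neqAle normr_ge0 andbT eq_sym; apply/negP => /eqP h; case/negP: v0.
  apply/eqP/rowP => j; rewrite mxE; apply/eqP; rewrite -normr_eq0 eq_le normr_ge0 andbT.
  by rewrite -h vk.
exists k; rewrite -(ler_pM2l vk0) -normrM mulrBr.
have /rowP/(_ k) := vA; rewrite !mxE (bigD1 k) //= [a * _]mulrC => e.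
rewrite -e addrAC subrr add0r mulr_sumr.
apply: le_trans (ler_norm_sum _ _ _) _; apply: ler_sum => j _.
by rewrite normrM ler_wpM2r.
Qed.

Lemma horner_char_poly (R : comNzRingType) n (A : 'M[R]_n) (x : R) :
  (char_poly A).[x] = \det (x%:M - A).
Proof.
have -> : (char_poly A).[x] = horner_eval x (char_poly A) by [].
rewrite /char_poly -det_map_mx; congr (\det _); apply/matrixP => i j.
by rewrite !mxE /= /horner_eval !(hornerE, hornerMn).
Qed.

Lemma cvg_bigsum (R : realType) (I : finType) (F : I -> nat -> R) (l : I -> R) :
  (forall i, F i @ \oo --> l i) -> (fun N => \sum_i F i N) @ \oo --> \sum_i l i.
Proof.
move=> Fl; elim: (index_enum I) => [|i r IH].
  by under eq_fun do rewrite big_nil; rewrite big_nil; exact: cvg_cst.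
by under eq_fun do rewrite big_cons; rewrite big_cons; exact: cvgD.
Qed.

Lemma cvg_bigprod (R : realType) (I : finType) (F : I -> nat -> R) (l : I -> R) :
  (forall i, F i @ \oo --> l i) -> (fun N => \prod_i F i N) @ \oo --> \prod_i l i.
Proof.
move=> Fl; elim: (index_enum I) => [|i r IH].
  by under eq_fun do rewrite big_nil; rewrite big_nil; exact: cvg_cst.
by under eq_fun do rewrite big_cons; rewrite big_cons; exact: cvgM.
Qed.

Section Convergence.
Variables (R : realType) (n : nat) (A : nat -> 'M[R]_n.+1) (d : 'I_n.+1 -> R).
Variable lam : nat -> 'I_n.+1 -> R.
Hypothesis det_lam : forall N x, \det (x%:M - A N) = \prod_i (x - lam N i).
Hypothesis tr_lam : forall N, \tr (A N) = \sum_i lam N i.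
Hypothesis cvgA : forall i j, (fun N => A N i j) @ \oo --> (if i == j then d i else 0).

Lemma cvg_det_char x :
  (fun N => \det (x%:M - A N)) @ \oo --> \prod_i (x - d i).
Proof.
have -> : \prod_i (x - d i) = \det (x%:M - diag_mx (\row_i d i)).
  rewrite -[x%:M]diag_const_mx -linearB det_diag.
  by apply: eq_bigr => i _; rewrite !mxE.
apply: cvg_bigsum => s; apply: cvgM; first exact: cvg_cst.
apply: cvg_bigprod => i; under eq_fun do rewrite !mxE.
rewrite !mxE; apply: cvgB; first exact: cvg_cst.
by have := @cvgA i (s i); case: eqP => [<-|] //; rewrite ?mulr1n ?mulr0n.
Qed.

Lemma eigen_near_diag (e : R) : 0 < e ->
  \forall N \near \oo, forall i, exists k, `|lam N i - d k| < e.
Proof.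
(* The column sum costs at most [n.+1] times [e'], and replacing [A N k k] by [d k] costs one
   more. *)
move=> e0; set e' := e / n.+2%:R.
have e'0 : 0 < e' by rewrite divr_gt0.
have h : \forall N \near \oo, forall ij : 'I_n.+1 * 'I_n.+1,
    `|(if ij.1 == ij.2 then d ij.1 else 0) - A N ij.1 ij.2| < e'.
  apply: filter_forall => -[i j]; have /cvgrPdist_lt := @cvgA i j; exact.
apply: filterS h => N h i.
have : eigenvalue (A N) (lam N i).
  rewrite eigenvalue_root_char /root horner_char_poly det_lam; apply/eqP.
  by rewrite (bigD1 i) //= subrr mul0r.
case/gershgorin => k hk; exists k.
have := h (k, k); rewrite /= eqxx => hkk.
have hs : \sum_(j | j != k) `|A N j k| <= \sum_(j < n.+1) e'.
  rewrite [leRHS](bigD1 k) //= -[leLHS]add0r; apply: lerD; first exact: ltW.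
  apply: ler_sum => j jk; have := h (j, k); rewrite /= (negPf jk) sub0r normrN.
  exact: ltW.
have -> : lam N i - d k = (lam N i - A N k k) - (d k - A N k k) by ring.
apply: le_lt_trans (ler_normB _ _) _.
apply: lt_le_trans (ler_ltD (le_trans hk hs) hkk) _.
by rewrite sumr_const card_ord -[X in _ + X]mulr1n -mulrnDr addn1 -mulr_natr divfK.
Qed.

(** If every eigenvalue were at distance at least [e] from [d k], the determinant of [d k - A N]
    would have modulus at least [e ^+ n.+1]; but it tends to 0. *)
Lemma diag_near_eigen k (e : R) : 0 < e ->
  \forall N \near \oo, exists i, `|lam N i - d k| < e.
Proof.
move=> e0; have := @cvg_det_char (d k).
have -> : \prod_i (d k - d i) = 0 by rewrite (bigD1 k) //= subrr mul0r.
move=> /cvgrPdist_lt /(_ (e ^+ n.+1)); rewrite exprn_gt0 // => /(_ isT).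
apply: filterS => N; rewrite sub0r normrN det_lam normr_prod => h.
apply: contrapT => /forallNP far; move: h; apply/negP; rewrite -leNgt.
have -> : e ^+ n.+1 = \prod_(i < n.+1) e by rewrite prodr_const card_ord.
apply: ler_prod => i _; rewrite (ltW e0) distrC leNgt.
by apply/negP; exact: far.
Qed.

(** The top eigenvalue is close to some [d j <= d k], which bounds it above. It also dominates the
    eigenvalue found close to [d k], which bounds it below. *)
Lemma cvg_lmax k : (forall N (i j : 'I_n.+1), (i <= j)%N -> lam N j <= lam N i) ->
  (forall j, d j <= d k) -> (fun N => lam N ord0) @ \oo --> d k.
Proof.
move=> sorted dk; apply/cvgrPdist_lt => e e0.
near=> N.
have [j hj] : exists j, `|lam N ord0 - d j| < e.
  by move: ord0; near: N; exact: eigen_near_diag.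
have [i hi] : exists i, `|lam N i - d k| < e by near: N; exact: diag_near_eigen.
have := sorted N ord0 i (leq0n _); have := dk j.
move: hi hj; rewrite !ltr_norml => /andP[? ?] /andP[? ?] ? ?; lra.
Unshelve. all: by end_near. Qed.

Lemma cvg_lmin k : (forall N (i j : 'I_n.+1), (i <= j)%N -> lam N j <= lam N i) ->
  (forall j, d k <= d j) -> (fun N => lam N ord_max) @ \oo --> d k.
Proof.
move=> sorted dk; apply/cvgrPdist_lt => e e0.
near=> N.
have [j hj] : exists j, `|lam N ord_max - d j| < e.
  by move: ord_max; near: N; exact: eigen_near_diag.
have [i hi] : exists i, `|lam N i - d k| < e by near: N; exact: diag_near_eigen.
have := sorted N i ord_max (leq_ord _); have := dk j.
move: hi hj; rewrite !ltr_norml => /andP[? ?] /andP[? ?] ? ?; lra.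
Unshelve. all: by end_near. Qed.

Lemma cvg_sum_eigen : (fun N => \sum_i lam N i) @ \oo --> \sum_i d i.
Proof.
under eq_fun do rewrite -tr_lam.
apply: cvg_bigsum => i; have := @cvgA i i; by rewrite eqxx.
Qed.
End Convergence.

(** * Spectrum of a scalar multiple *)

Section ScaledSpectrum.
Variables (R : fieldType) (n : nat) (B : 'M[R]_n.+1) (lam : 'I_n.+1 -> R) (c : R).
Hypothesis Blam : char_poly B = \prod_i ('X - (lam i)%:P).

Lemma det_scaled x : \det (x%:M - c *: B) = \prod_i (x - c * lam i).
Proof.
(* The scale may vanish: in use it is the inverse of 0, hence 0, at [N = 0]. *)
have [->|c0] := eqVneq c 0.
  rewrite scale0r subr0 det_scalar -[n.+1 in LHS]card_ord -prodr_const.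
  by apply: eq_bigr => i _; rewrite mul0r subr0.
have -> : x%:M - c *: B = c *: ((x / c)%:M - B).
  by rewrite scalerBr scale_scalar_mx mulrC divfK.
rewrite detZ -horner_char_poly Blam horner_prod -[X in c ^+ X](card_ord n.+1) -prodr_const -big_split.
by apply: eq_bigr => i _; rewrite /= !hornerE mulrBr mulrCA divff // mulr1.
Qed.

(** The trace and the sum of the [lam i] are both minus the coefficient of degree [n] of the
    characteristic polynomial. *)
Lemma trace_scaled : \tr (c *: B) = \sum_i c * lam i.
Proof.
rewrite linearZ /= -mulr_sumr; congr (_ * _).
apply: oppr_inj; rewrite -char_poly_trace // Blam.
have := @coefPn_prod_XsubC _ [seq lam i | i <- enum 'I_n.+1].
by rewrite size_map size_enum_ord !big_map -!enumT !big_enum => /(_ isT) /= ->.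
Qed.
End ScaledSpectrum.

(** * Expectation of a product of independent variables *)

Section Density.
Import HBNNSimple.

(** An identity of measures on measurable sets passes to nonnegative functions: first to simple ones
    by linearity, then by monotone convergence. It serves to split off one independent factor, to
    integrate against the normal density, and to transfer integrals to the law of a variable. *)
Lemma ge0_integral_density {d d'} {T : measurableType d} {T' : measurableType d'}
    {R : realType} (mu : {measure set T -> \bar R}) (nu : {measure set T' -> \bar R})
    (X : T -> T') (G : T -> R) (c : R) (g : T' -> R) :
  measurable_fun setT X -> measurable_fun setT G -> (forall w, 0 <= G w) -> 0 <= c ->
  (forall A, measurable A ->
    (\int[mu]_w (\1_A (X w) * G w)%:E = c%:E * nu A)%E) ->
  measurable_fun setT g -> (forall x, 0 <= g x) ->
  (\int[mu]_w (g (X w) * G w)%:E = c%:E * \int[nu]_x (g x)%:E)%E.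
Proof.
move=> mX mG G0 c0 hA mg g0.
have mA (h : {nnsfun T' >-> R}) (y : R) : measurable (h @^-1` [set y]).
  by rewrite -[X in measurable X]setTI; exact: measurable_funPT.
have m1 (A : set T') : measurable A -> measurable_fun setT (fun w => \1_A (X w) : R).
  move=> hm; apply: (@measurable_indic _ _ _ _ (X @^-1` A)).
  by rewrite -[X in measurable X]setTI; exact: mX.
have simple (h : {nnsfun T' >-> R}) :
    (\int[mu]_w (h (X w) * G w)%:E = c%:E * \int[nu]_x (h x)%:E)%E.
  pose s := fset_set (range h).
  have s0 (i : 'I_#|` s|) : 0 <= s`_i.
    have : s`_i \in s by rewrite mem_nth.
    by rewrite in_fset_set// inE => -[x _ <-]; exact: fun_ge0.
  under eq_integral do rewrite (fimfunEord h) mulr_suml -sumEFin.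
  under [in RHS]eq_integral do rewrite (fimfunEord h) -sumEFin.
  rewrite [LHS]ge0_integral_sum//; last 2 first.
  - move=> i; apply/measurable_EFinP/measurable_funM => //.
    by apply: measurable_funM => //; exact: m1.
  - by move=> i w _; rewrite lee_fin !mulr_ge0// ?s0.
  rewrite ge0_integral_sum//; last 2 first.
  - move=> i; apply/measurable_EFinP/measurable_funM => //; exact: measurable_indic.
  - by move=> i w _; rewrite lee_fin mulr_ge0// ?s0.
  rewrite ge0_sume_distrr; last first.
    by move=> i _; apply: integral_ge0 => w _; rewrite lee_fin mulr_ge0// ?s0.
  apply: eq_bigr => i _.
  under eq_integral do rewrite -mulrA EFinM.
  under [in RHS]eq_integral do rewrite EFinM.
  rewrite [LHS]ge0_integralZl// ?lee_fin ?s0//; last 2 first.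
  - apply/measurable_EFinP/measurable_funM => //; exact: m1.
  - by move=> w _; rewrite lee_fin !mulr_ge0.
  rewrite ge0_integralZl// ?lee_fin ?s0//; last first.
  - exact/measurable_EFinP/measurable_indic.
  by rewrite hA// muleCA integral_indic// setIT.
have mg' : measurable_fun setT (EFin \o g) by exact/measurable_EFinP.
pose h := nnsfun_approx measurableT mg'.
have hg x : (h n x)%:E @[n --> \oo] --> (g x)%:E.
  by apply: (@cvg_nnsfun_approx _ _ _ _ measurableT _ mg') => // ? _; rewrite lee_fin.
have nd x : {homo h^~ x : n m / (n <= m)%N >-> n <= m}.
  by move=> n m nm; have /lefP := @nd_nnsfun_approx _ _ _ _ measurableT _ mg' _ _ nm; exact.
have limG : (\int[mu]_w (h n (X w) * G w)%:E @[n --> \oo] --> \int[mu]_w (g (X w) * G w)%:E)%E.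
  under [in X in _ --> X]eq_integral.
    move=> w _; rewrite (_ : (_%:E) = limn (fun n => (h n (X w) * G w)%:E)); first over.
    apply/esym/cvg_lim => //; under eq_fun do rewrite EFinM.
    by rewrite EFinM; apply: cvgeZr.
  apply: cvg_monotone_convergence => //.
  - move=> n; apply/measurable_EFinP/measurable_funM => //.
    by apply: measurableT_comp => //.
  - by move=> n w _; rewrite lee_fin mulr_ge0.
  - by move=> w _ m n mn; rewrite lee_fin ler_wpM2r// nd.
have lim1 : (\int[nu]_x (h n x)%:E @[n --> \oo] --> \int[nu]_x (g x)%:E)%E.
  under [in X in _ --> X]eq_integral.
    move=> x _; rewrite (_ : (_%:E) = limn (fun n => (h n x)%:E)); first over.
    by apply/esym/cvg_lim.
  apply: cvg_monotone_convergence => //.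
  - by move=> n; apply/measurable_EFinP.
  - by move=> n w _; rewrite lee_fin.
  - by move=> w _ m n mn; rewrite lee_fin nd.
have limG' : (\int[mu]_w (h n (X w) * G w)%:E @[n --> \oo] -->
    c%:E * \int[nu]_x (g x)%:E)%E.
  by under eq_fun do rewrite simple; exact: cvgeZl.
exact: (cvg_unique _ limG limG').
Qed.
End Density.

Section Indep.
Context {d} {Omega : measurableType d} {R : realType} (P : probability Omega R).
Variables (I : finType) (X : I -> {RV P >-> R}).
Hypothesis indepX : mutually_independent P X.

(** Induction on a list [J] outside which every factor is already an indicator. For empty [J] the
    claim is the definition of independence. In the inductive step the claim with an arbitrary
    indicator at [j] extends to [f j] by [ge0_integral_density]. *)
Lemma ge0_integral_prod_indep (f : I -> R -> R) :
  (forall k, measurable_fun setT (f k)) -> (forall k x, 0 <= f k x) ->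
  (forall k, \int[P]_w (f k (X k w))%:E < +oo)%E ->
  (\int[P]_w (\prod_k f k (X k w))%:E =
     \big[*%E/1%E]_k \int[P]_w (f k (X k w))%:E)%E.
Proof.
have mX k : measurable_fun setT (X k) by exact: measurable_funPT.
have mXA k (A : set R) : measurable A -> measurable (X k @^-1` A).
  by move=> ?; rewrite -[X in measurable X]setTI; exact: mX.
have int1 k (A : set R) : measurable A ->
    (\int[P]_w (\1_A (X k w))%:E = P (X k @^-1` A))%E.
  by move=> mA; rewrite (integral_indic P measurableT (mXA k _ mA)) setIT.
suff gen (J : seq I) : (forall k, k \notin J -> exists A, measurable A /\ f k = \1_A) ->
    (forall k, measurable_fun setT (f k)) -> (forall k x, 0 <= f k x) ->
    (forall k, \int[P]_w (f k (X k w))%:E < +oo)%E ->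
    (\int[P]_w (\prod_k f k (X k w))%:E =
     \big[*%E/1%E]_k \int[P]_w (f k (X k w))%:E)%E.
  by apply: (gen (enum I)) => k; rewrite mem_enum.
elim: J f => [|j J IH] f indicf mf f0 foo.
  have /choice[A hA] : forall k, exists A, measurable A /\ f k = \1_A.
    by move=> k; exact: indicf.
  have mA k : measurable (A k) by have [] := hA k.
  under [RHS]eq_bigr do rewrite (hA _).2 int1//.
  rewrite -indepX//.
  have -> : (fun w => (\prod_k f k (X k w))%:E) =
      (fun w => (\1_(\bigcap_(k in [set: I]) X k @^-1` A k) w)%:E).
    apply/funext => w; congr EFin.
    have [h|] := pselect ((\bigcap_(k in [set: I]) X k @^-1` A k) w).
      rewrite indicE mem_set//; apply: big1 => k _.
      by rewrite (hA k).2 indicE mem_set//; exact: h.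
    move=> h; rewrite indicE memNset//; move/existsNP: h => [k /not_implyP[_ h]].
    by rewrite (bigD1 k)//= (hA k).2 indicE memNset// mul0r.
  rewrite integral_indic ?setIT//; apply: fin_bigcap_measurable => // k _; exact: mXA.
pose f' g k := if k == j then g else f k.
pose G w := \prod_(k | k != j) f k (X k w).
(* The remaining integrals are finite by hypothesis, so their product is a real constant. *)
pose c := fine (\big[*%E/1%E]_(k | k != j) \int[P]_w (f k (X k w))%:E)%E.
have cE : (\big[*%E/1%E]_(k | k != j) \int[P]_w (f k (X k w))%:E)%E = c%:E.
  rewrite fineK//; apply: (big_ind (fun x : \bar R => x \is a fin_num)) => //.
    by move=> x y; exact: fin_numM.
  move=> k _; rewrite ge0_fin_numE ?foo//; apply: integral_ge0 => w _.
  by rewrite lee_fin.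
have splitP g w : \prod_k f' g k (X k w) = g (X j w) * G w.
  rewrite (bigD1 j)//= {1}/f' eqxx; congr (_ * _); apply: eq_bigr => k /negPf kj.
  by rewrite /f' kj.
have splitE g : (\big[*%E/1%E]_k \int[P]_w (f' g k (X k w))%:E =
    \int[P]_w (g (X j w))%:E * c%:E)%E.
  rewrite (bigD1 j)//= {1}/f' eqxx -cE; congr (_ * _)%E; apply: eq_bigr => k /negPf kj.
  by rewrite /f' kj.
have f'j : f' (f j) = f by apply/funext => k; rewrite /f'; case: eqP => [->|].
rewrite -f'j splitE muleC; under eq_integral do rewrite splitP.
have -> : (\int[P]_w (f j (X j w))%:E = \int[distribution P (X j)]_x (f j x)%:E)%E.
  rewrite ge0_integral_distribution//; last by move=> x; rewrite lee_fin.
  exact/measurable_EFinP.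
apply: ge0_integral_density => //.
- rewrite /G; under eq_fun do rewrite -big_filter.
  by apply: measurable_prod => k _; exact: measurableT_comp.
- by move=> w; apply: prodr_ge0.
- by rewrite -lee_fin -cE; apply: prode_ge0 => k _; apply: integral_ge0 => w _; rewrite lee_fin.
(* With an indicator at [j] the index leaves the list, so the induction hypothesis supplies the
   identity of measures relating [G] to [c]. *)
move=> A mA; transitivity (c%:E * \int[P]_w (\1_A (X j w))%:E)%E; last by rewrite int1.
rewrite muleC -splitE; under eq_integral do rewrite -splitP.
apply: IH.
- move=> k kJ; rewrite /f'; case: eqP => [_|/eqP kj]; first by exists A.
  by apply: indicf; rewrite inE negb_or kj.
- move=> k; rewrite /f'; case: eqP => // _; exact: measurable_indic.
- by move=> k x; rewrite /f'; case: eqP.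
- move=> k; rewrite /f'; case: eqP => // _; rewrite int1//.
  by apply: le_lt_trans (probability_le1 _ _) _; rewrite ?ltry//; exact: mXA.
Qed.

Lemma fin_integral_prod_indep (f : I -> R -> R) :
  (forall k, measurable_fun setT (f k)) -> (forall k x, 0 <= f k x) ->
  (forall k, P.-integrable setT (fun w => (f k (X k w))%:E)) ->
  (\int[P]_w (\prod_k f k (X k w))%:E =
     (\prod_k fine (\int[P]_w (f k (X k w))%:E))%:E)%E.
Proof.
move=> mf f0 intf; rewrite ge0_integral_prod_indep//; last first.
  by move=> k; rewrite -ge0_fin_numE ?integrable_fin_num// integral_ge0// => w _; rewrite lee_fin.
by rewrite -prodEFin; apply: eq_bigr => k _; rewrite fineK// integrable_fin_num.
Qed.

(** The absolute value of the product is the product of the absolute values, to which the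
    nonnegative case applies. *)
Lemma integrable_prod_indep (f : I -> R -> R) :
  (forall k, measurable_fun setT (f k)) ->
  (forall k, P.-integrable setT (fun w => (f k (X k w))%:E)) ->
  P.-integrable setT (fun w => (\prod_k f k (X k w))%:E).
Proof.
move=> mf intf; apply/integrableP; split.
  apply/measurable_EFinP; apply: measurable_prod => k _.
  by apply: measurableT_comp => //; exact: measurable_funPT.
under eq_integral do rewrite abse_EFin normr_prod.
rewrite (@fin_integral_prod_indep (fun k x => `|f k x|)) ?ltry//.
  by move=> k; exact: measurableT_comp.
by move=> k; have := integrable_abse (intf k).
Qed.

(* Each factor is split into positive and negative parts and the product expanded. *)
Lemma integral_prod_indep (f : I -> R -> R) :
  (forall k, measurable_fun setT (f k)) ->
  (forall k, P.-integrable setT (fun w => (f k (X k w))%:E)) ->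
  (\int[P]_w (\prod_k f k (X k w))%:E =
     (\prod_k fine (\int[P]_w (f k (X k w))%:E))%:E)%E.
Proof.
move=> mf intf.
pose sg (b : bool) : R := if b then 1 else -1.
pose h (b : bool) k x := Num.max (sg b * f k x) 0.
have mX k : measurable_fun setT (X k) by exact: measurable_funPT.
have h0 b k x : 0 <= h b k x by rewrite le_max lexx orbT.
have mh b k : measurable_fun setT (h b k).
  by apply: measurable_maxr => //; exact: measurable_funM.
have inth b k : P.-integrable setT (fun w => (h b k (X k w))%:E).
  apply: le_integrable (intf k) => //.
    by apply/measurable_EFinP; exact: measurableT_comp.
  move=> w _; rewrite !abse_EFin lee_fin ger0_norm// /h /sg ge_max normr_ge0 andbT.
  by case: b; rewrite ?mul1r ?mulN1r ?ler_norm// -normrN ler_norm.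
have fh k x : f k x = \sum_b sg b * h b k x.
  rewrite big_bool /h /sg /= !mul1r !mulN1r.
  have [f0|] := boolP (0 <= f k x).
    by rewrite max_l// max_r ?oppr_le0// subr0.
  by rewrite -ltNge => f0; rewrite max_r ?ltW// max_l ?oppr_ge0 ?ltW// opprK add0r.
under eq_integral.
  move=> w _; under eq_bigr do rewrite fh.
  rewrite bigA_distr_bigA /=; under eq_bigr do rewrite big_split /=.
  rewrite -sumEFin; over.
rewrite integral_sum//; last first.
  move=> phi; under eq_fun do rewrite EFinM; apply: integrableZl => //.
  exact: (@integrable_prod_indep (fun k => h (phi k) k)).
rewrite (eq_bigr (fun phi : {ffun I -> bool} =>
    (\prod_k (sg (phi k) * fine (\int[P]_w (h (phi k) k (X k w))%:E)%E))%:E)); last first.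
  move=> phi _; under eq_integral do rewrite EFinM.
  rewrite integralZl//; last exact: (@integrable_prod_indep (fun k => h (phi k) k)).
  by rewrite (@fin_integral_prod_indep (fun k => h (phi k) k))// -EFinM -big_split.
rewrite sumEFin; congr EFin.
(* The sum over sign patterns is folded back into a product of signed sums, now of integrals. *)
rewrite -(bigA_distr_bigA (fun k b => sg b * fine (\int[P]_w (h b k (X k w))%:E)%E)) /=.
apply: eq_bigr => k _.
transitivity (fine (\int[P]_w (\sum_b (sg b)%:E * (h b k (X k w))%:E)))%E; last first.
  congr fine; apply: eq_integral => w _; rewrite fh -sumEFin.
  by apply: eq_bigr => b _; rewrite EFinM.
rewrite integral_sum//; last by move=> b; exact: integrableZl.
rewrite (eq_bigr (fun b => (sg b * fine (\int[P]_w (h b k (X k w))%:E)%E)%:E)).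
  by rewrite sumEFin.
by move=> b _; rewrite integralZl// EFinM fineK// integrable_fin_num.
Qed.
End Indep.

(** * Moments of the normal distribution *)

Section NormalMoments.
Context {R : realType}.
Variable s : R.
Hypothesis s0 : 0 < s.
Notation nu := (normal_prob 0 s).
Notation mu := (@lebesgue_measure R).

Lemma ge0_integral_normal (f : R -> R) : measurable_fun setT f -> (forall x, 0 <= f x) ->
  (\int[nu]_x (f x)%:E = \int[mu]_x (f x * normal_pdf 0 s x)%:E)%E.
Proof.
move=> mf f0.
rewrite (@ge0_integral_density _ _ _ _ _ mu nu id (normal_pdf 0 s) 1 f) ?mul1e//.
- exact: measurable_normal_pdf.
- exact: normal_pdf_ge0.
move=> A mA; rewrite mul1e /normal_prob [RHS]integral_mkcond.
apply: eq_integral => x _; rewrite /= patchE indicE.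
by case: ifP => _; rewrite ?mul1r ?mul0r.
Qed.

(** Completing the square turns the exponential times the centred density into [expR (t ^+ 2 / 2)]
    times the density of mean [t * s]. The bounds on all moments and the value of the second one are
    drawn from this formula. *)
Lemma integral_normal_expR (t : R) :
  (\int[nu]_x (expR (t * (x / s)))%:E = (expR (t ^+ 2 / 2))%:E)%E.
Proof.
have sn0 : s != 0 by rewrite gt_eqF.
rewrite ge0_integral_normal//; last first.
  by apply: measurableT_comp => //; apply: measurable_funM => //; exact: measurable_funM.
transitivity (\int[mu]_x ((expR (t ^+ 2 / 2))%:E * (normal_pdf (t * s) s x)%:E))%E.
  apply: eq_integral => x _; rewrite -EFinM; congr EFin.
  rewrite !normal_pdfE// mulrCA [RHS]mulrCA; congr (_ * _).
  rewrite /normal_fun -!expRD; congr expR; field; exact: sn0.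
rewrite ge0_integralZl ?integral_normal_pdf ?mule1// ?lee_fin ?expR_ge0//.
- by apply/measurable_EFinP; exact: measurable_normal_pdf.
- by move=> x _; rewrite lee_fin normal_pdf_ge0.
Qed.

(** The line is cut at 0 and the negative half is reflected; replacing [f] by its reflection then
    swaps the two halves. *)
Lemma ge0_integral_opp (f : R -> R) : continuous f -> (forall x, 0 <= f x) ->
  (\int[mu]_x (f (- x))%:E = \int[mu]_x (f x)%:E)%E.
Proof.
have half (g : R -> R) : continuous g -> (forall x, 0 <= g x) ->
    (\int[mu]_x (g x)%:E = \int[mu]_(x in `[0%R, +oo[) (g x)%:E
      + \int[mu]_(x in `[0%R, +oo[) (g (- x))%:E)%E.
  move=> cg g0; have mg : measurable_fun setT g by exact: continuous_measurable_fun.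
  rewrite -(setUv (`[0, +oo[ : set R)) ge0_integral_setU//=; last 4 first.
  - exact: measurableC.
  - by apply/measurable_EFinP; rewrite setUv.
  - by move=> x _; rewrite lee_fin.
  - exact/disj_setPCl.
  congr (_ + _)%E; rewrite setCitvr integral_itv_bndo_bndc; last first.
    exact/measurable_EFinP/measurable_funTS.
  by rewrite -{1}oppr0 ge0_integration_by_substitutionNy//; exact: continuous_subspaceT.
move=> cf f0; rewrite half//; last first.
  by move=> x; apply: continuous_comp; [exact: continuousN|exact: cf].
by under [X in (_ + X)%E]eq_integral do rewrite opprK; rewrite addeC -half.
Qed.

Lemma ge0_integral_normal_opp (f : R -> R) : continuous f -> (forall x, 0 <= f x) ->
  (\int[nu]_x (f (- x))%:E = \int[nu]_x (f x)%:E)%E.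
Proof.
move=> cf f0; have sn0 : s != 0 by rewrite gt_eqF.
have cpdf := @continuous_normal_pdf R 0 s sn0.
rewrite !ge0_integral_normal//.
- rewrite -[RHS]ge0_integral_opp//.
  + apply: eq_integral => x _; congr ((_ * _)%:E).
    by rewrite !normal_pdfE// /normal_fun !subr0 sqrrN.
  + by move=> x; apply: continuousM; [exact: cf|exact: cpdf].
  + by move=> x; rewrite mulr_ge0// normal_pdf_ge0.
- exact: continuous_measurable_fun.
- by apply: measurableT_comp => //; exact: continuous_measurable_fun.
Qed.

End NormalMoments.

(** * Inequalities for exponentials and hyperbolic cosines *)

Section ExpBounds.
Context {R : realType}.
Implicit Types w z y t : R.

(** This is [2 cosh z - 2 = (2 sinh (z / 2))^2]; it reduces the bounds on [cosh] to bounds on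
    [sinh]. *)
Lemma expR_add_expRN z : expR z + expR (- z) - 2 = (expR (z / 2) - expR (- (z / 2))) ^+ 2.
Proof.
have e : expR (z / 2) * expR (- (z / 2)) = 1 by rewrite expRxMexpNx_1.
rewrite {1 2}(splitr z) opprD !expRD.
transitivity (expR (z / 2) * expR (z / 2) + expR (- (z / 2)) * expR (- (z / 2))
  - 2 * (expR (z / 2) * expR (- (z / 2)))); first by rewrite e mulr1.
ring.
Qed.

(** The difference of the two sides vanishes at 0 and its derivative is a square by
    [expR_add_expRN]. *)
Lemma expR_sub_expRN_ge w : 0 <= w -> 2 * w <= expR w - expR (- w).
Proof.
move=> w0; pose f x : R := expR x - expR (- x) - 2 * x.
have df (x : R) : is_derive x 1 f (expR x + expR (- x) - 2).
  rewrite /f; apply: is_derive_eq; rewrite !scaler1 /GRing.scale /=; ring.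
suff : f 0 <= f w by rewrite /f oppr0 mulr0 subrr subr0 subr_ge0.
apply: (@ger0_derive1_le_cc _ f 0 w) => //; rewrite ?in_itv /= ?lexx ?w0//.
- by move=> x _; rewrite derive1E derive_val expR_add_expRN sqr_ge0.
- apply: continuous_subspaceT => x; apply: differentiable_continuous.
  by apply/derivable1_diffP.
Qed.

Lemma sqr_le_cosh z : z ^+ 2 <= expR z + expR (- z) - 2.
Proof.
wlog z0 : z / 0 <= z => [h|].
  have [/h//|z0] := leP 0 z; have := h (- z); rewrite oppr_ge0 ltW// => /(_ isT).
  by rewrite sqrrN opprK [X in X - _]addrC.
rewrite expR_add_expRN ler_pXn2r ?nnegrE//.
- by have := @expR_sub_expRN_ge (z / 2); rewrite divr_ge0// => /(_ isT); lra.
- by rewrite subr_ge0 ler_expR; lra.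
Qed.

(** Multiply [1 - y <= expR (- y)] by [expR y]. *)
Lemma expR_sub1_le y : expR y - 1 <= y * expR y.
Proof.
have e : expR y * expR (- y) = 1 by rewrite expRxMexpNx_1.
have := expR_ge1Dx (- y); have := expR_gt0 y; nra.
Qed.

Lemma cosh_le_sqr z : expR z + expR (- z) - 2 <= z ^+ 2 * expR `|z|.
Proof.
wlog z0 : z / 0 <= z => [h|].
  have [/h//|z0] := leP 0 z; have := h (- z); rewrite oppr_ge0 ltW// => /(_ isT).
  by rewrite sqrrN opprK [X in X - _]addrC normrN ltr0_norm// -(ltr0_norm z0).
rewrite ger0_norm// expR_add_expRN.
have -> : z ^+ 2 * expR z = (z * expR (z / 2)) ^+ 2.
  by rewrite {2}(splitr z) expRD; ring.
rewrite ler_pXn2r ?nnegrE ?mulr_ge0 ?expR_ge0//.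
  have e : expR (z / 2) * expR (- (z / 2)) = 1 by rewrite expRxMexpNx_1.
  have := expR_sub1_le (z / 2); have := @expR_ge1Dx _ (- (z / 2)).
  have : 1 <= expR (z / 2) by rewrite -expR0 ler_expR divr_ge0.
  nra.
by rewrite subr_ge0 ler_expR; lra.
Qed.

(** One term of the exponential series is at most its sum. Both signs occur on the right so that the
    bound has a known normal integral. *)
Lemma exprn_le_expR y k : `|y| ^+ k <= k`!%:R * (expR y + expR (- y)).
Proof.
have h : expR `|y| <= expR y + expR (- y).
  have [y0|y0] := leP 0 y; first by rewrite ger0_norm// lerDl expR_ge0.
  by rewrite ltr0_norm// lerDr expR_ge0.
apply: le_trans (_ : k`!%:R * expR `|y| <= _); last by rewrite ler_wpM2l.
case: k => [|k]; first by rewrite expr0 fact0 mul1r -expR0 ler_expR.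
rewrite [leRHS]mulrC -ler_pdivrMr ?ltr0n ?fact_gt0//.
by apply: le_trans (@expR_ge1Dxn _ `|y| k (normr_ge0 _)); rewrite lerDr.
Qed.

(** A second-order Taylor bound whose cubic remainder is integrable. One factor [expR |y|] absorbs
    [|y| ^+ 3] with the constant [3! = 6], and another absorbs [expR (t * |y|)]; hence the argument
    [2 * y]. *)
Lemma cosh_scale_le t y : 0 < t -> t <= 1 ->
  expR (t * y) + expR (- t * y) <=
    2 + t ^+ 2 * y ^+ 2 + t ^+ 3 * 6 * (expR (2 * y) + expR (- 2 * y)).
Proof.
move=> t0 t1; have := cosh_le_sqr (t * y); rewrite normrM (ger0_norm (ltW t0)) -mulNr.
have h1 := expR_sub1_le (t * `|y|).
have h2 : expR (t * `|y|) <= expR `|y| by rewrite ler_expR ler_piMl.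
have h3 : `|y| ^+ 3 <= 6 * expR `|y|.
  have := @expR_ge1Dxn _ `|y| 2 (normr_ge0 _); rewrite (_ : 3`!%:R = 6)//; lra.
have h4 : expR `|y| * expR `|y| <= expR (2 * y) + expR (- 2 * y).
  rewrite -expRD; have [y0|y0] := leP 0 y.
    by rewrite ger0_norm// (_ : 2 * y = y + y) ?lerDl ?expR_ge0//; ring.
  by rewrite ltr0_norm// (_ : - 2 * y = - y - y) ?lerDr ?expR_ge0//; ring.
have e0 := expR_ge0 `|y|; have e1 := expR_ge0 (t * `|y|); have y0 := normr_ge0 y.
have y2 : y ^+ 2 = `|y| ^+ 2 by rewrite real_normK ?num_real.
have h5 : `|y| ^+ 3 * expR (t * `|y|) <= 6 * (expR (2 * y) + expR (- 2 * y)).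
  apply: le_trans (_ : 6 * (expR `|y| * expR `|y|) <= _); last by rewrite ler_wpM2l.
  by rewrite mulrA; apply: ler_pM => //; exact: exprn_ge0.
have h6 : (t * y) ^+ 2 * (expR (t * `|y|) - 1) <= (t * y) ^+ 2 * (t * `|y| * expR (t * `|y|)).
  by rewrite ler_wpM2l ?sqr_ge0.
have h7 : (t * y) ^+ 2 * (t * `|y| * expR (t * `|y|)) = t ^+ 3 * (`|y| ^+ 3 * expR (t * `|y|)).
  by rewrite exprMn y2; ring.
have h8 : t ^+ 3 * (`|y| ^+ 3 * expR (t * `|y|)) <=
    t ^+ 3 * (6 * (expR (2 * y) + expR (- 2 * y))) by rewrite ler_pM2l ?exprn_gt0.
have : (t * y) ^+ 2 = t ^+ 2 * y ^+ 2 by rewrite exprMn.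
lra.
Qed.
End ExpBounds.

(** * Moments of the standardised normal variable *)

Section NormalMoments2.
Context {R : realType}.
Variable s : R.
Hypothesis s0 : 0 < s.
Notation nu := (normal_prob 0 s).

Let measurable_scale : measurable_fun [set: R] (fun x : R => x / s).
Proof. exact: measurable_funM. Qed.

Lemma integrable_normal_expR t :
  nu.-integrable setT (EFin \o (fun x : R => expR (t * (x / s)))).
Proof.
apply/integrableP; split.
  by apply/measurable_EFinP; apply: measurableT_comp => //; exact: measurable_funM.
under eq_integral do rewrite /= ger0_norm ?expR_ge0//.
by rewrite integral_normal_expR// ltry.
Qed.

Lemma Rintegral_normal_expR t :
  \int[nu]_x expR (t * (x / s)) = expR (t ^+ 2 / 2).
Proof. by rewrite /Rintegral integral_normal_expR. Qed.

Lemma integrable_normal_cosh t c : nu.-integrable setT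
  (EFin \o (fun x : R => c * (expR (t * (x / s)) + expR (- t * (x / s))))).
Proof.
rewrite (_ : _ \o _ = (fun x => c%:E * ((EFin \o (fun x : R => expR (t * (x / s)))) x
  + (EFin \o (fun x : R => expR (- t * (x / s)))) x))%E); last by apply/funext => x.
by apply: integrableZl => //; apply: integrableD => //; exact: integrable_normal_expR.
Qed.

Lemma Rintegral_normal_cosh t c :
  \int[nu]_x (c * (expR (t * (x / s)) + expR (- t * (x / s)))) = c * (2 * expR (t ^+ 2 / 2)).
Proof.
have h := integrable_normal_cosh t 1.
rewrite RintegralZl//; last by move: h; congr (_.-integrable _ _); apply/funext => x /=; rewrite mul1r.
rewrite RintegralD//; [|exact: integrable_normal_expR..].
by rewrite !Rintegral_normal_expR sqrrN mulrDl mul1r.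
Qed.

Lemma integrable_normal_pow k : nu.-integrable setT (EFin \o (fun x : R => (x / s) ^+ k)).
Proof.
apply: le_integrable (integrable_normal_cosh 1 k`!%:R) => //.
  by apply/measurable_EFinP; exact: measurable_funX.
move=> x _; rewrite /= lee_fin mulN1r mul1r normrX.
by apply: le_trans (exprn_le_expR _ _) (ler_norm _).
Qed.

Lemma normal_pow_le k :
  `|\int[nu]_x ((x / s) ^+ k)| <= k`!%:R * (2 * expR (2^-1)).
Proof.
apply: le_trans (le_normr_Rintegral _ _) _ => //; first exact: integrable_normal_pow.
have := Rintegral_normal_cosh 1 k`!%:R; rewrite expr1n div1r => <-.
apply: le_Rintegral => //.
- by have := integrable_abse (integrable_normal_pow k).
- exact: integrable_normal_cosh.
by move=> x _; rewrite normrX mulN1r mul1r exprn_le_expR.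
Qed.

(** Reflection is available for nonnegative functions only, so it is applied to [|p| + p] with [p]
    the odd power. It yields [|p| - p], and equal integrals force that of [p] to vanish. *)
Lemma normal_pow_odd k : odd k -> \int[nu]_x ((x / s) ^+ k) = 0.
Proof.
move=> ok; pose f x : R := `|(x / s) ^+ k| + (x / s) ^+ k.
have intk := integrable_normal_pow k.
have intkn : nu.-integrable setT (EFin \o (fun x : R => `|(x / s) ^+ k|)).
  by have := integrable_abse intk.
have f0 x : 0 <= f x by have := ler_norm (- (x / s) ^+ k); rewrite /f normrN; lra.
have cf : continuous f.
  have cp : continuous (fun x : R => (x / s) ^+ k).
    move=> x; apply: (@continuous_comp R R R (fun x : R => x / s) (fun x : R => x ^+ k) x).
      by apply: continuousM => //; exact: cst_continuous.
    exact: exprn_continuous.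
  by move=> x; apply: cvgD; [apply: cvg_norm; exact: cp|exact: cp].
have : \int[nu]_x f (- x) = \int[nu]_x f x.
  by rewrite /Rintegral ge0_integral_normal_opp.
have fN x : f (- x) = `|(x / s) ^+ k| - (x / s) ^+ k.
  by rewrite /f mulNr exprNn -signr_odd ok expr1 mulN1r normrN.
under eq_Rintegral do rewrite fN.
rewrite RintegralB// RintegralD//; lra.
Qed.

Lemma le_of_forall_linear (a b C : R) :
  (forall t : R, 0 < t -> t <= 1 -> a <= b + C * t) -> a <= b.
Proof.
move=> h; rewrite leNgt; apply/negP => ba.
pose e := a - b; have e0 : 0 < e by rewrite subr_gt0.
(* This choice makes [t <= 1] and [C * t < e]. *)
pose t := e / (e + `|C| * 2 + 1).
have D0 : 0 < e + `|C| * 2 + 1 by have := normr_ge0 C; lra.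
have tD : t * (e + `|C| * 2 + 1) = e by rewrite divfK// gt_eqF.
have t0 : 0 < t by rewrite divr_gt0.
have t1 : t <= 1 by rewrite ler_pdivrMr// mul1r; have := normr_ge0 C; lra.
have := h _ t0 t1; have := ler_norm C; rewrite /e in tD e0 *.
have := normr_ge0 C; nra.
Qed.

(** Integrating [2 cosh (t y) = 2 + t^2 y^2 + O(t^3)] and comparing with the exact value
    [2 * expR (t ^+ 2 / 2)] identifies the coefficient of [t^2] as [t] tends to 0. *)
Lemma normal_pow2 : \int[nu]_x ((x / s) ^+ 2) = 1.
Proof.
set m := LHS.
have int2 := integrable_normal_pow 2.
have int2t t : nu.-integrable setT (EFin \o (fun x : R => t ^+ 2 * (x / s) ^+ 2)).
  rewrite (_ : _ \o _ = (fun x => (t ^+ 2)%:E * (EFin \o (fun x : R => ((x / s) ^+ 2)%R)) x)%E);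
    last by apply/funext => x.
  exact: integrableZl.
have intc (c : R) : nu.-integrable setT (EFin \o (fun x : R => c)).
  exact: finite_measure_integrable_cst.
have intD (f g : R -> R) : nu.-integrable setT (EFin \o f) -> nu.-integrable setT (EFin \o g) ->
    nu.-integrable setT (EFin \o (fun x => f x + g x)).
  by move=> hf hg; have := integrableD measurableT hf hg.
have cstE (c : R) : \int[nu]_x (fun=> c) x = c.
  by rewrite Rintegral_cst//= /normal_prob integral_normal_pdf /= mulr1.
have low (t : R) : 2 + t ^+ 2 * m <= 2 * expR (t ^+ 2 / 2).
  have := Rintegral_normal_cosh t 1; rewrite !mul1r => <-.
  rewrite -(cstE 2) -RintegralZl// -RintegralD//.
  apply: le_Rintegral => //; first exact: intD.
    exact: integrable_normal_cosh.
  move=> x _; have := sqr_le_cosh (t * (x / s)); rewrite exprMn mulNr; lra.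
have up (t : R) : 0 < t -> t <= 1 ->
    2 * expR (t ^+ 2 / 2) <= 2 + t ^+ 2 * m + t ^+ 3 * 6 * (2 * expR (2 ^+ 2 / 2)).
  move=> t0 t1; rewrite -Rintegral_normal_cosh.
  have := Rintegral_normal_cosh t 1; rewrite !mul1r => <-.
  rewrite -(cstE 2) -RintegralZl// -RintegralD//.
  rewrite -RintegralD//; [|exact: intD|exact: integrable_normal_cosh].
  apply: le_Rintegral => //; first exact: integrable_normal_cosh.
    by apply: (intD) (intD _ _ _ _) _ => //; exact: integrable_normal_cosh.
  by move=> x _; rewrite mul1r !cstE; exact: cosh_scale_le.
have m0 : 0 <= m by apply: Rintegral_ge0 => x _; exact: sqr_ge0.
apply/eqP; rewrite eq_le; apply/andP; split.
  (* From [m <= E] and [E * (1 - t^2 / 2) <= 1] follows [m <= 1 + (m / 2) * t^2], and [t^2 <= t]. *)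
  apply: (@le_of_forall_linear _ _ (m / 2)) => t t0 t1.
  have := low t; have := expR_sub1_le (t ^+ 2 / 2).
  have e : expR (t ^+ 2 / 2) * expR (- (t ^+ 2 / 2)) = 1 by rewrite expRxMexpNx_1.
  have e1 := expR_ge1Dx (- (t ^+ 2 / 2)).
  have e0 := expR_gt0 (t ^+ 2 / 2).
  set E := expR (t ^+ 2 / 2) in e e0 * => hE hl.
  have t2 : 0 < t ^+ 2 by rewrite exprn_gt0.
  have mE : m <= E by rewrite -(ler_pM2l t2); lra.
  have h1 : E * (1 - t ^+ 2 / 2) <= 1 by rewrite -[leRHS]e ler_pM2l.
  have h2 : m * (1 - t ^+ 2 / 2) <= E * (1 - t ^+ 2 / 2).
    by rewrite ler_wpM2r// subr_ge0; nra.
  have : m * t ^+ 2 <= m * t by rewrite ler_wpM2l//; nra.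
  lra.
(* The constant is the integral of the cubic remainder, 6 times [2 * expR (2 ^+ 2 / 2)]. *)
apply: (@le_of_forall_linear _ _ (12 * expR (2 ^+ 2 / 2))) => t t0 t1.
have := up t t0 t1; have := expR_ge1Dx (t ^+ 2 / 2).
set E := expR (2 ^+ 2 / 2).
have t2 : 0 < t ^+ 2 by rewrite exprn_gt0.
move=> h1 h2; rewrite -(ler_pM2l t2).
have -> : t ^+ 2 * (m + 12 * E * t) = t ^+ 2 * m + t ^+ 3 * 6 * (2 * E) by ring.
lra.
Qed.

End NormalMoments2.

(** * Asymptotics of the moment matrix *)

Section RVMoment.
Context {d} {Omega : measurableType d} {R : realType} (P : probability Omega R).
Variables (X : {RV P >-> R}) (s : R).
Hypothesis s0 : 0 < s.
Hypothesis law : forall A : set R, measurable A -> distribution P X A = normal_prob 0 s A.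

Let ge0_law (f : R -> R) : measurable_fun setT f -> (forall x, 0 <= f x) ->
  (\int[P]_w (f (X w))%:E = \int[normal_prob 0 s]_x (f x)%:E)%E.
Proof.
move=> mf f0.
have mX : measurable_fun setT X by exact: measurable_funPT.
have hA A : measurable A -> (\int[P]_w (\1_A (X w) * cst 1 w)%:E = 1%:E * normal_prob 0 s A)%E.
  move=> mA; under eq_integral do rewrite mulr1; rewrite mul1e -law//.
  have mXA : measurable (X @^-1` A) by rewrite -[X in measurable X]setTI; exact: mX.
  by rewrite (integral_indic P measurableT mXA) setIT.
have m1 : measurable_fun setT (cst 1 : Omega -> R) by exact: measurable_cst.
have := @ge0_integral_density _ _ _ _ _ P (normal_prob 0 s) X (cst 1) 1 f mX m1
  (fun=> ler01) ler01 hA mf f0.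
by rewrite mul1e => <-; apply: eq_integral => w _; rewrite mulr1.
Qed.

Let integral_law (f : R -> R) : measurable_fun setT f ->
  (\int[P]_w (f (X w))%:E = \int[normal_prob 0 s]_x (f x)%:E)%E.
Proof.
move=> mf; rewrite integralE [RHS]integralE; congr (_ - _)%E.
- under eq_integral do rewrite funeposE -EFin_max.
  under [RHS]eq_integral do rewrite funeposE -EFin_max.
  apply: (ge0_law (f := fun x => Num.max (f x) 0)); first exact: measurable_maxr.
  by move=> x; rewrite le_max lexx orbT.
- under eq_integral do rewrite funenegE -EFinN -EFin_max.
  under [RHS]eq_integral do rewrite funenegE -EFinN -EFin_max.
  apply: (ge0_law (f := fun x => Num.max (- f x) 0)).
    by apply: measurable_maxr => //; exact: measurableT_comp.
  by move=> x; rewrite le_max lexx orbT.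
Qed.

Lemma integrable_rv_pow k : P.-integrable setT (fun w => (X w ^+ k)%:E).
Proof.
have mX : measurable_fun setT X by exact: measurable_funPT.
apply/integrableP; split; first by apply/measurable_EFinP; exact: measurable_funX.
under eq_integral do rewrite abse_EFin.
rewrite (ge0_law (f := fun x => `|x ^+ k|))//; last first.
  by apply: measurableT_comp => //; exact: measurable_funX.
have -> : (\int[normal_prob 0 s]_x (`|x ^+ k|)%:E =
    \int[normal_prob 0 s]_x ((`|s ^+ k|)%:E * (`|(x / s) ^+ k|)%:E))%E.
  by apply: eq_integral => x _; rewrite -EFinM -normrM -exprMn mulrC divfK// gt_eqF.
rewrite ge0_integralZl//.
- apply: lte_mul_pinfty => //.
  by have /integrableP[_] := integrable_normal_pow s0 k.
- apply/measurable_EFinP; apply: measurableT_comp => //; apply: measurable_funX.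
  exact: measurable_funM.
Qed.

Lemma rv_pow k : fine (\int[P]_w (X w ^+ k)%:E)%E =
  s ^+ k * \int[normal_prob 0 s]_x ((x / s) ^+ k).
Proof.
rewrite -RintegralZl//; last exact: integrable_normal_pow.
congr fine.
rewrite (integral_law (f := fun x => x ^+ k)); last exact: measurable_funX.
by apply: eq_integral => x _; rewrite -exprMn mulrC divfK// gt_eqF.
Qed.
End RVMoment.

Lemma beta_walk (R : realType) N (W : 'I_N -> 'I_N -> R) i l :
  beta W i l = \sum_(p : l.-tuple 'I_N) \prod_(e <- walk_edges i p) W e.1 e.2.
Proof.
apply: eq_bigr => p _; rewrite (big_nth (i, i)) big_mkord size_pairmap size_tuple.
by apply: eq_bigr => k _; rewrite (nth_pairmap i) ?size_tuple.
Qed.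

Section Entry.
Context {d} {Omega : measurableType d} {R : realType} (P : probability Omega R).
Variables (N : nat) (W : 'I_N -> 'I_N -> {RV P >-> R}) (s : R).
Hypothesis s0 : 0 < s.
Hypothesis indep : mutually_independent P (fun k : 'I_N * 'I_N => W k.1 k.2).
Hypothesis law : forall i j (A : set R), measurable A ->
  distribution P (W i j) A = normal_prob 0 s A.

Definition std_moment k : R := \int[normal_prob 0 s]_x ((x / s) ^+ k).

(** Both factors [beta] are expanded over walks from a common root and equal edges are grouped;
    independence then factors each expectation over the directed edges. *)
Lemma moment_matrix_walk T (a b : 'I_T.+1) :
  moment_matrix P W T a b =
  s ^+ (a + b) * \sum_(x : 'I_N * (a.-tuple 'I_N * b.-tuple 'I_N)) walk_term std_moment x.
Proof.
rewrite mxE unlock.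
under eq_integral.
  move=> w _.
  have -> : \sum_(i < N) beta (fun a b => W a b w) i a * beta (fun a b => W a b w) i b =
    \sum_(x : 'I_N * (a.-tuple 'I_N * b.-tuple 'I_N))
      \prod_(e : 'I_N * 'I_N) W e.1 e.2 w ^+ count_mem e (edges_pair x).
    under eq_bigr do rewrite !beta_walk big_distrlr /= pair_big /=.
    rewrite pair_big /=; apply: eq_bigr => -[i [p q]] _ /=.
    by rewrite -big_cat prod_seq_count.
  rewrite -sumEFin; over.
have intx (x : 'I_N * (a.-tuple 'I_N * b.-tuple 'I_N)) (e : 'I_N * 'I_N) :
    P.-integrable setT (fun w => (W e.1 e.2 w ^+ count_mem e (edges_pair x))%:E).
  exact: (integrable_rv_pow s0 (law e.1 e.2)).
have mpow k : measurable_fun setT (fun x : R => x ^+ k) by exact: measurable_funX.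
rewrite integral_sum//; last first.
  move=> x; exact: (integrable_prod_indep indep (f := fun e y => y ^+ count_mem e (edges_pair x))).
rewrite mulr_sumr -[RHS]/(fine (_ : R)%:E) -sumEFin; congr fine; apply: eq_bigr => x _.
rewrite (integral_prod_indep indep (f := fun e y => y ^+ count_mem e (edges_pair x)))//.
(* The multiplicities add up to [a + b], so [s ^+ (a + b)] is distributed over the edges. *)
congr EFin; rewrite -{1}(size_edges_pair x) -sum_count_mem -prodrXr -big_split /=.
by apply: eq_bigr => e _; rewrite (rv_pow s0 (law e.1 e.2)).
Qed.

Lemma std_moment0 : std_moment 0 = 1.
Proof.
rewrite /std_moment; under eq_Rintegral do rewrite expr0.
by rewrite Rintegral_cst//= /normal_prob integral_normal_pdf /= mulr1.
Qed.

Lemma std_moment_le L k : (k <= L)%N ->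
  `|std_moment k| <= (L`!%:R * (2 * expR 2^-1)) ^+ k.
Proof.
case: k => [|k] kL; first by rewrite std_moment0 expr0 normr1.
set c := 2 * expR _.
have c1 : 1 <= c.
  have : 1 <= expR 2^-1 :> R by rewrite -expR0 ler_expR invr_ge0.
  by rewrite /c; lra.
apply: le_trans (normal_pow_le s0 k.+1) _.
have le1 : k.+1`!%:R * c <= L`!%:R * c.
  by rewrite ler_pM2r ?ler_nat ?leq_fact// (lt_le_trans ltr01).
apply: le_trans le1 _; rewrite exprS ler_peMr//.
  by rewrite mulr_ge0// (le_trans ler01).
by apply: exprn_ege1; rewrite -[leLHS]mulr1 ler_pM// ler1n fact_gt0.
Qed.

End Entry.

(** The constant of [sum_walk_term] for the moment bound of [std_moment_le]. It is independent of
    [N] and of the variance. *)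
Definition entry_const (R : realType) (L : nat) : R :=
  ((L`!%:R * (2 * expR 2^-1)) ^+ L + 2) * (L./2 ^ L.+1 + L./2 ^ L./2.+1)%:R.

Lemma moment_matrix_entry {d} {Omega : measurableType d} {R : realType}
  (P : probability Omega R) N (W : 'I_N -> 'I_N -> {RV P >-> R}) (s : R) T (a b : 'I_T.+1) :
  (0 < N)%N -> 0 < s ->
  mutually_independent P (fun k : 'I_N * 'I_N => W k.1 k.2) ->
  (forall i j (A : set R), measurable A -> distribution P (W i j) A = normal_prob 0 s A) ->
  `|moment_matrix P W T a b - (if a == b then N%:R * (s * Num.sqrt N%:R) ^+ (a + b) else 0)|
    <= entry_const R (a + b) * (s * Num.sqrt N%:R) ^+ (a + b).
Proof.
move=> N0 s0 indep law; rewrite (moment_matrix_walk s0 indep law).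
set r := Num.sqrt N%:R.
have r2 : r ^+ 2 = N%:R by rewrite sqr_sqrtr.
have r1 : 1 <= r by rewrite -sqrtr1 ler_sqrt ?ler1n// ltr0n.
set M := (a + b)`!%:R * (2 * expR 2^-1) : R.
have M1 : 1 <= M.
  have e1 : 1 <= expR 2^-1 :> R by rewrite -expR0 ler_expR invr_ge0.
  have f1 : 1 <= (a + b)`!%:R :> R by rewrite ler1n fact_gt0.
  by rewrite /M -[leLHS]mulr1 ler_pM//; lra.
have := @sum_walk_term R N a b (std_moment s) M M1 (std_moment0 s) (normal_pow2 s0)
  (normal_pow_odd s0) (fun k => @std_moment_le R s s0 (a + b) k).
set S := \sum_x _ => h.
have -> : s ^+ (a + b) * S - (if a == b then N%:R * (s * r) ^+ (a + b) else 0) =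
    s ^+ (a + b) * (S - (if (a == b :> nat) then N%:R ^+ a.+1 else 0)).
  rewrite mulrBr; congr (_ - _); rewrite -val_eqE /=; case: eqP => [<-|_]; last by rewrite mulr0.
  by rewrite exprMn mulrCA addnn -mul2n [r ^+ _]exprM r2 -exprS.
rewrite normrM ger0_norm ?exprn_ge0 ?(ltW s0)// exprMn mulrCA ler_pM2l ?exprn_gt0//.
apply: le_trans h _; apply: ler_wpM2l.
  by rewrite mulr_ge0// addr_ge0// exprn_ge0// (le_trans ler01).
(* For odd [a + b] the halving rounds down; the lost factor [r] is at least 1. *)
rewrite -r2 -exprM; apply: ler_weXn2l => //; lia.
Qed.

(** * Limits of the rescaled spectrum *)

Lemma cvg_of_dist (R : realType) (f g h : nat -> R) (l : R) :
  (\forall N \near \oo, `|f N - g N| <= h N) -> h @ \oo --> (0 : R) -> g @ \oo --> l ->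
  f @ \oo --> l.
Proof.
move=> fg h0 gl.
have : (fun N => f N - g N) @ \oo --> (0 : R).
  apply/cvgr0Pnorm_lt => e e0; move/cvgr0Pnorm_lt: h0 => /(_ _ e0).
  apply: filterS2 fg => N le1; apply: le_lt_trans.
  exact: le_trans le1 (ler_norm _).
move=> /(cvgD)/(_ gl); rewrite add0r; apply: cvg_trans; apply: near_eq_cvg.
by near=> N => /=; rewrite subrK.
Unshelve. all: by end_near. Qed.

Lemma cvg_inv_nat (R : realType) : (fun N : nat => (N%:R : R)^-1) @ \oo --> (0 : R).
Proof. by rewrite -cvg_shiftS; exact: cvg_harmonic. Qed.

Lemma cvg_powRN (R : realType) (b : R) : 0 < b ->
  (fun N : nat => (N%:R `^ (- b) : R)) @ \oo --> (0 : R).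
Proof.
move=> b0; apply/cvgr0Pnorm_lt => e e0.
near=> N.
have N0 : 0 < N%:R :> R by rewrite ltr0n; near: N; exists 1%N.
rewrite ger0_norm ?powR_ge0// powRN invf_plt ?posrE ?powR_gt0//.
have -> : e^-1 = (e^-1 `^ (b^-1)) `^ b by rewrite -powRrM mulVf ?gt_eqF// powRr1 ?invr_ge0 ?ltW.
apply: gt0_ltr_powR => //; rewrite ?nnegrE ?powR_ge0 ?ltW//.
by near: N; exact: nbhs_infty_gtr.
Unshelve. all: by end_near. Qed.

Section ScaledLimit.
Variables (R : realType) (T : nat) (B : nat -> 'M[R]_T.+1) (lam : nat -> 'I_T.+1 -> R).
Variables (s : nat -> R) (C : nat -> R).
Hypothesis lamB : forall N, sorted_eigenvalues (B N) (lam N).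
Hypothesis entryB : forall N (a b : 'I_T.+1), (0 < N)%N ->
  `|B N a b - (if a == b then N%:R * s N ^+ (a + b) else 0)| <= C (a + b)%N * s N ^+ (a + b).
(* In use, [c N = 1 / (N s^(2K))] with [r = s] for [K = 0] and [r = 1/s] for [K = T]. *)
Variables (c r : nat -> R) (r0 : R) (n : 'I_T.+1 -> 'I_T.+1 -> nat).
Hypothesis c0 : forall N, 0 <= c N.
Hypothesis cP : forall N, (0 < N)%N -> 0 < c N.
Hypothesis cr : forall N (a b : 'I_T.+1), (0 < N)%N -> N%:R * c N * s N ^+ (a + b) = r N ^+ n a b.
Hypothesis r_cvg : r @ \oo --> r0.

Let pos_near : \forall N \near \oo, (0 < N)%N. Proof. by exists 1%N. Qed.

(** The error bound lacks the factor [N] of the main term, so after scaling it is of order [1 / N]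
    times a convergent sequence. *)
Lemma cvg_scaled_entry a b :
  (fun N => (c N *: B N) a b) @ \oo --> (if a == b then r0 ^+ n a b else 0).
Proof.
have rn : (fun N => r N ^+ n a b) @ \oo --> r0 ^+ n a b.
  by apply: (cvg_comp r (fun x : R => x ^+ n a b) r_cvg); exact: exprn_continuous.
apply: (@cvg_of_dist _ _ (fun N => if a == b then r N ^+ n a b else 0)
  (fun N => C (a + b)%N * (N%:R^-1 * r N ^+ n a b))).
- apply: filterS pos_near => N N0.
  have N0' : N%:R != 0 :> R by rewrite pnatr_eq0 -lt0n.
  have -> : (c N *: B N) a b - (if a == b then r N ^+ n a b else 0) =
      c N * (B N a b - (if a == b then N%:R * s N ^+ (a + b) else 0)).
    rewrite !mxE mulrBr; congr (_ - _); case: ifP; rewrite ?mulr0// -cr//.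
    by rewrite -mulrA mulrCA.
  rewrite normrM ger0_norm//; apply: le_trans (ler_wpM2l (c0 N) (entryB _ _ N0)) _.
  by rewrite -cr// -!mulrA mulKf// mulrCA.
- rewrite -[0](mulr0 (C (a + b)%N)); apply: cvgM; first exact: cvg_cst.
  rewrite -[0](mul0r (r0 ^+ n a b)); apply: cvgM => //; exact: cvg_inv_nat.
- by case: ifP => _ //; exact: cvg_cst.
Qed.

Let det_lam N x : \det (x%:M - c N *: B N) = \prod_i (x - c N * lam N i).
Proof. by apply: det_scaled; have [] := lamB N. Qed.

Let tr_lam N : \tr (c N *: B N) = \sum_i c N * lam N i.
Proof. by apply: trace_scaled; have [] := lamB N. Qed.

Let sorted N (i j : 'I_T.+1) : (i <= j)%N -> c N * lam N j <= c N * lam N i.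
Proof. by move=> ij; rewrite ler_wpM2l//; have [_] := lamB N; exact. Qed.

Let cvgA a b : (fun N => (c N *: B N) a b) @ \oo -->
  (if a == b then (fun a => r0 ^+ n a a) a else 0).
Proof. by have := @cvg_scaled_entry a b; case: eqP => [->|]. Qed.

Lemma cvg_scaled_max k : (forall j, r0 ^+ n j j <= r0 ^+ n k k) ->
  (fun N => c N * lam N ord0) @ \oo --> r0 ^+ n k k.
Proof. exact: (cvg_lmax det_lam cvgA (k := k) sorted). Qed.

Lemma cvg_scaled_min k : (forall j, r0 ^+ n k k <= r0 ^+ n j j) ->
  (fun N => c N * lam N ord_max) @ \oo --> r0 ^+ n k k.
Proof. exact: (cvg_lmin det_lam cvgA (k := k) sorted). Qed.

(** The scale cancels in the quotient once [N > 0], and the scaled total converges because it is a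
    trace. *)
Lemma cvg_ratio k : (forall j, r0 ^+ n j j <= r0 ^+ n k k) ->
  \sum_j r0 ^+ n j j != 0 ->
  (fun N => lam N ord0 / \sum_j lam N j) @ \oo --> r0 ^+ n k k / \sum_j r0 ^+ n j j.
Proof.
move=> km S0.
have H : (fun N => c N * lam N ord0 / \sum_j (c N * lam N j)) @ \oo -->
    r0 ^+ n k k / \sum_j r0 ^+ n j j.
  exact: cvgM (cvg_scaled_max km) (cvgV S0 (cvg_sum_eigen tr_lam cvgA)).
apply: cvg_trans H; apply: near_eq_cvg; apply: filterS pos_near => N N0 /=.
by rewrite -mulr_sumr invfM mulrACA divff ?mul1r// gt_eqF// cP.
Qed.
End ScaledLimit.

(** The starting value is itself a value of [F]; in use [F ord0 = 1]. *)
Lemma bigmax_attained (R : realType) n (F : 'I_n.+1 -> R) :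
  exists k, \big[Num.max/F ord0]_j F j = F k.
Proof.
apply: (big_ind (fun x => exists k, x = F k)); first by exists ord0.
  by move=> _ _ [k ->] [l ->]; case: (leP (F k) (F l)) => _; [exists l|exists k].
by move=> k _; exists k.
Qed.

Lemma bigmin_attained (R : realType) n (F : 'I_n.+1 -> R) :
  exists k, \big[Num.min/F ord0]_j F j = F k.
Proof.
apply: (big_ind (fun x => exists k, x = F k)); first by exists ord0.
  by move=> _ _ [k ->] [l ->]; case: (leP (F k) (F l)) => _; [exists k|exists l].
by move=> k _; exists k.
Qed.

(** * The three regimes of [alpha] *)

Theorem mainTheorem12 (R : realType) (T : nat) (rho alpha : R)
  (d : nat -> measure_display) (Omega : forall N : nat, measurableType (d N))
  (P : forall N : nat, probability (Omega N) R)
  (W : forall N : nat, 'I_N -> 'I_N -> {RV (P N) >-> R})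
  (lam : nat -> 'I_T.+1 -> R) :
  (0 < T)%N -> 0 < rho ->
  (forall N : nat, (0 < N)%N ->
     mutually_independent (P N) (fun k : 'I_N * 'I_N => W N k.1 k.2)) ->
  (forall N : nat, (0 < N)%N -> forall i j : 'I_N, forall A : set R, measurable A ->
     distribution (P N) (W N i j) A = normal_prob 0 (rho / (N%:R `^ alpha)) A) ->
  (forall N : nat, sorted_eigenvalues (moment_matrix (P N) (W N) T) (lam N)) ->
  let Mx : R := \big[Num.max/1]_(k < T.+1) rho ^+ (2 * k) in
  let Mn : R := \big[Num.min/1]_(k < T.+1) rho ^+ (2 * k) in
  let S := \sum_(k < T.+1) rho ^+ (2 * k) in
  let lmax := fun N : nat => lam N ord0 in
  let lmin := fun N : nat => lam N ord_max in
  let tot := fun N : nat => \sum_(k < T.+1) lam N k in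
  (alpha = 2^-1 ->
     (fun N : nat => lmax N / (N%:R * Mx)) @ \oo --> (1:R) /\
     (fun N : nat => lmin N / (N%:R * Mn)) @ \oo --> (1:R) /\
     (fun N : nat => lmax N / tot N) @ \oo --> (Mx / S : R)) /\
  (alpha < 2^-1 ->
     (fun N : nat => lmax N /
        (rho ^+ (2 * T) * N%:R `^ (1 + 2 * T%:R * (2^-1 - alpha)))) @ \oo --> (1:R) /\
     (fun N : nat => lmax N / tot N) @ \oo --> (1:R)) /\
  (2^-1 < alpha ->
     (fun N : nat => lmax N / N%:R) @ \oo --> (1:R) /\
     (fun N : nat => lmax N / tot N) @ \oo --> (1:R)).
Proof.
move=> _ rho0 indep law lamB Mx Mn S lmax lmin tot.
pose B N := moment_matrix (P N) (W N) T.
(* The standard deviation times [sqrt N]. Its behaviour separates the regimes: constant, divergent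
   or vanishing. *)
pose s N : R := rho * N%:R `^ (2^-1 - alpha).
have N0' N : (0 < N)%N -> 0 < N%:R :> R by rewrite ltr0n.
have s0 N : (0 < N)%N -> 0 < s N by move=> /N0' N0; rewrite mulr_gt0// powR_gt0.
have entryB N (a b : 'I_T.+1) : (0 < N)%N ->
    `|B N a b - (if a == b then N%:R * s N ^+ (a + b) else 0)| <=
      entry_const R (a + b)%N * s N ^+ (a + b).
  move=> N0; have -> : s N = rho / N%:R `^ alpha * Num.sqrt N%:R.
    rewrite /s powRB; last by rewrite pnatr_eq0 -lt0n N0 implybT.
    by rewrite powR12_sqrt// mulrA mulrAC.
  apply: moment_matrix_entry => //.
  - by rewrite divr_gt0// powR_gt0// N0'.
  - exact: indep.
  - exact: law.
have V0 N : 0 <= (N%:R : R)^-1 by rewrite invr_ge0.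
have VP N : (0 < N)%N -> 0 < (N%:R : R)^-1 by move=> /N0'; rewrite invr_gt0.
have NV N : (0 < N)%N -> N%:R * (N%:R : R)^-1 = 1 by move=> /N0'?; rewrite divff// gt_eqF.
have e2 (j : nat) : rho ^+ (2 * j) = rho ^+ (j + j) by rewrite mul2n addnn.
have pow0 j : (0 : R) ^+ j <= 1 by rewrite expr0n; case: eqP.
split; [|split] => a12.
(* Here [s N = rho] for [N > 0], so [B N / N] tends to the diagonal matrix with entries
   [rho ^+ (2 * k)]. *)
- pose n (a b : 'I_T.+1) := (a + b)%N.
  pose F (k : 'I_T.+1) : R := rho ^+ (2 * k).
  have cr N (a b : 'I_T.+1) : (0 < N)%N -> N%:R * N%:R^-1 * s N ^+ (a + b) = rho ^+ n a b.
    by move=> N0; rewrite NV// mul1r /s a12 subrr powRr0 mulr1.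
  have rc : (fun _ : nat => rho) @ \oo --> rho by exact: cvg_cst.
  have F0 : F ord0 = 1 by rewrite /F muln0 expr0.
  have [k] := bigmax_attained F; rewrite F0 -/Mx => kE.
  have [l] := bigmin_attained F; rewrite F0 -/Mn => lE.
  have kmax j : rho ^+ n j j <= rho ^+ n k k.
    by rewrite /n -!e2 -/(F k) -kE; exact: (le_bigmax _ F).
  have lmin' j : rho ^+ n l l <= rho ^+ n j j.
    by rewrite /n -!e2 -/(F l) -lE; exact: (bigmin_le _ _ F).
  have Mx0 : Mx != 0 by rewrite kE gt_eqF// exprn_gt0.
  have Mn0 : Mn != 0 by rewrite lE gt_eqF// exprn_gt0.
  have SE : \sum_j rho ^+ n j j = S by apply: eq_bigr => j _; rewrite e2.
  have S0 : \sum_j rho ^+ n j j != 0.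
    rewrite big_ord_recl gt_eqF// ltr_pwDl ?exprn_gt0// sumr_ge0// => j _.
    by rewrite exprn_ge0// ltW.
  split; [|split].
  + have := @cvg_scaled_max R T B lam s _ lamB entryB _ _ _ n V0 cr rc k kmax.
    rewrite /n -e2 -/(F k) -kE => /(cvgM (cvg_cst Mx^-1)); rewrite mulVf//.
    rewrite (_ : (fun N => lmax N / _) = (fun N => Mx^-1 * (N%:R^-1 * lam N ord0)))//.
    by apply/funext => N; rewrite invfM mulrC -mulrA mulrCA.
  + have := @cvg_scaled_min R T B lam s _ lamB entryB _ _ _ n V0 cr rc l lmin'.
    rewrite /n -e2 -/(F l) -lE => /(cvgM (cvg_cst Mn^-1)); rewrite mulVf//.
    rewrite (_ : (fun N => lmin N / _) = (fun N => Mn^-1 * (N%:R^-1 * lam N ord_max)))//.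
    by apply/funext => N; rewrite invfM mulrC -mulrA mulrCA.
  + have := @cvg_ratio R T B lam s _ lamB entryB _ _ _ n V0 VP cr rc k kmax S0.
    by rewrite SE /n -e2 -/(F k) -kE.
(* Here [s N] diverges and the last diagonal entry dominates. Division by its leading term leaves
   powers of [r = 1 / s], and the truncated subtraction is exact since [a, b <= T]. In the limit
   only [0 ^+ 0 = 1] at [ord_max] survives. *)
- pose n (a b : 'I_T.+1) := (2 * T - (a + b))%N.
  pose c N : R := (rho ^+ (2 * T) * N%:R `^ (1 + 2 * T%:R * (2^-1 - alpha)))^-1.
  pose r N : R := rho^-1 * N%:R `^ (- (2^-1 - alpha)).
  have c0 N : 0 <= c N by rewrite invr_ge0 mulr_ge0 ?powR_ge0// exprn_ge0// ltW.
  have cP N : (0 < N)%N -> 0 < c N.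
    by move=> /N0' N0; rewrite invr_gt0 mulr_gt0 ?powR_gt0// exprn_gt0.
  have cE N : (0 < N)%N -> c N = (N%:R * s N ^+ (2 * T))^-1.
    move=> N0; congr (_^-1); rewrite /s exprMn mulrCA; congr (_ * _).
    rewrite powRD; last by rewrite pnatr_eq0 -lt0n N0 implybT.
    by rewrite powRr1// mulrC [_ * (2^-1 - _)]mulrC powRrM -natrM powR_mulrn ?powR_ge0// mulrC.
  have cr N (a b : 'I_T.+1) : (0 < N)%N -> N%:R * c N * s N ^+ (a + b) = r N ^+ n a b.
    move=> N0; have sn0 : s N != 0 by rewrite gt_eqF// s0.
    have -> : r N = (s N)^-1 by rewrite /r powRN -invfM.
    rewrite cE// invfM mulVKf ?gt_eqF ?N0'// exprVn.
    have ab : (a + b <= 2 * T)%N by have := ltn_ord a; have := ltn_ord b; lia.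
    by rewrite -[in LHS](subnK ab) exprD invfM -mulrA mulVf ?mulr1// expf_neq0.
  have rc : r @ \oo --> (0 : R).
    rewrite -[0](mulr0 rho^-1); apply: cvgM; first exact: cvg_cst.
    by apply: cvg_powRN; rewrite subr_gt0.
  have nT : n ord_max ord_max = 0%N by rewrite /n /=; lia.
  have kmax j : (0 : R) ^+ n j j <= 0 ^+ n ord_max ord_max by rewrite nT.
  have SE : \sum_j (0 : R) ^+ n j j = 1.
    rewrite (bigD1 ord_max)//= nT big1 ?addr0// => j.
    rewrite -val_eqE /= => jT; rewrite expr0n /n.
    by case: eqP => //; have := ltn_ord j; lia.
  have S0 : \sum_j (0 : R) ^+ n j j != 0 by rewrite SE oner_neq0.
  split.
  + have := @cvg_scaled_max R T B lam s _ lamB entryB _ _ _ n c0 cr rc ord_max kmax.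
    by rewrite nT; under eq_fun do rewrite mulrC; exact.
  + have := @cvg_ratio R T B lam s _ lamB entryB _ _ _ n c0 cP cr rc ord_max kmax S0.
    by rewrite SE nT divr1.
(* Here [s N] tends to 0, and after division by [N] only [0 ^+ 0 = 1] at [ord0] survives. *)
- pose n (a b : 'I_T.+1) := (a + b)%N.
  have cr N (a b : 'I_T.+1) : (0 < N)%N -> N%:R * N%:R^-1 * s N ^+ (a + b) = s N ^+ n a b.
    by move=> N0; rewrite NV// mul1r.
  have rc : s @ \oo --> (0 : R).
    rewrite -[0](mulr0 rho); apply: cvgM; first exact: cvg_cst.
    by rewrite /= -[2^-1 - alpha]opprB; apply: cvg_powRN; rewrite subr_gt0.
  have kmax j : (0 : R) ^+ n j j <= 0 ^+ n ord0 ord0 by [].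
  have SE : \sum_j (0 : R) ^+ n j j = 1.
    rewrite big_ord_recl /n expr0 big1 ?addr0// => j _.
    by rewrite expr0n.
  have S0 : \sum_j (0 : R) ^+ n j j != 0 by rewrite SE oner_neq0.
  split.
  + have := @cvg_scaled_max R T B lam s _ lamB entryB _ _ _ n V0 cr rc ord0 kmax.
    by rewrite /n expr0; under eq_fun do rewrite mulrC; exact.
  + have := @cvg_ratio R T B lam s _ lamB entryB _ _ _ n V0 VP cr rc ord0 kmax S0.
    by rewrite SE /n expr0 divr1.
Qed.
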